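(* Let $K$ be a Legendrian knot in $(\mathbb{R}^3,\xi_{st})$ with front projection $K_F$. The graded Euler characteristic of the Legendrian Khovanov homology groups of $K$ is the Legendrian Jones polynomial $P_K(A,r)$; that is, with $q=-A^{-2}$, $$\sum_{i,k,j\in\mathbb{Z}}(-1)^i\,r^k\,q^j\,\dim_{\mathbb{Z}_2}H_{i,k,j}(K_F)=P_K(A,r).$$
   Context: Contact setting. $\xi_{st}=\ker(dz-y\,dx)$ on $\mathbb{R}^3$. A Legendrian knot is a smooth embedding of $\mathbb{S}^1$ in $\mathbb{R}^3$ everywhere tangent to $\xi_{st}$. The front projection $K_F$ of $K$ is its image under $(x,y,z)\mapsto(x,z)$, always taken generic: a closed curve in the $xz$-plane with no vertical tangents, smooth except for finitely many left/right cusps, and with finitely many transverse double points (crossings). At each crossing the strand of smaller slope is the over-strand. Notation. $\omega(K_F)$ is the writhe (number of right-handed, i.e. positive, crossings minus number of left-handed, i.e. negative, crossings; independent of orientation for a knot), $l(K_F)$ is the number of left-handed (negative) crossings, $c(K_F)$ is the number of cusps. Resolutions and states. At a crossing, with the four ends called NW, NE, SW, SE, the $A$-resolution replaces the crossing by an arc joining NW to NE and a disjoint arc below it joining SW to SE, with no cusps; the $B$-resolution replaces it by an arc joining NW to SW through a new right cusp and a disjoint arc joining NE to SE through a new left cusp. A Legendrian state $s$ of $K_F$ is the result of resolving every crossing; it is a disjoint union of planar cusped loops. $A(s),B(s)$ are the numbers of $A$- and $B$-resolutions in $s$, $\sigma(s)=A(s)-B(s)$, $\|s\|$ is the number of loops,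 and $c(s)$ is the number of cusps of $s$. An enhanced Legendrian state $S$ is a Legendrian state $s$ with a label $+$ or $-$ on each loop; $\sigma(S)=\sigma(s)$, $c(S)=c(s)$, and $\tau(S)$ is the number of $+$ labels minus the number of $-$ labels. Gradings: $$i(S)=\tfrac{\omega(K_F)-\sigma(S)}{2},\quad j(S)=\tfrac{3\omega(K_F)-\sigma(S)+2\tau(S)}{2},\quad k(S)=\tfrac{c(S)-2l(K_F)+2\tau(S)}{2}.$$ Legendrian Jones polynomial. $$P_K(A,r)=(-A)^{-3\omega(K_F)}r^{\frac{c(K_F)}{2}-l(K_F)}\sum_{s}A^{\sigma(s)}r^{B(s)}(-A^2r^{-1}-A^{-2}r)^{\|s\|},$$ the sum running over all Legendrian states $s$ of $K_F$. Complex. $C(K_F)$ is the $\mathbb{Z}_2$-vector space with basis the enhanced Legendrian states of $K_F$, and $C_{i,k,j}(K_F)$ is the span of those $S$ with $i(S)=i$, $k(S)=k$, $j(S)=j$. A Legendrian state $t$ is incident with $s$ if they differ in resolution at exactly one crossing, where $s$ has the $A$-resolution and $t$ the $B$-resolution. An enhanced state $T$ is incident with $S$ if $t$ is incident with $s$, $j(S)=j(T)$, $k(S)=k(T)$, and the loops common to $s$ and $t$ (those not meeting the crossing where they differ) carry the same labels. The differential is $\partial(S)=\sum_T T$ over all enhanced states $T$ incident with $S$; it maps $C_{i,k,j}(K_F)$ to $C_{i+1,k,j}(K_F)$, and $H_{i,k,j}(K_F)=\ker(\partial|_{C_{i,k,j}(K_F)})/\partial(C_{i-1,k,j}(K_F))$.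 *)

(* Defs.v *)
From HB Require Import structures.
From mathcomp Require Import all_boot all_order all_algebra finmap.
From mathcomp Require Import all_classical all_reals all_analysis.

Set Implicit Arguments.
Unset Strict Implicit.
Unset Printing Implicit Defensive.

Import Order.TTheory GRing.Theory Num.Theory.

Local Open Scope ring_scope.

(** * Front diagrams and their states *)

(** A front cut open at its crossings: [nw v], [ne v], [sw v], [se v] are the
    arcs on which the four ends at the crossing [v] lie. *)
Record diagram := Diagram {
  arc : finType;
  crossing : finType;
  nw : crossing -> arc;
  ne : crossing -> arc;
  sw : crossing -> arc;
  se : crossing -> arc;
  right_handed : pred crossing;
  front_cusps : nat }.

Section States.
Variable D : diagram.

Definition writhe : int :=
  \sum_(v : crossing D) (if right_handed v then 1 else -1).

Definition left_handed_crossings : nat :=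
  #|[pred v : crossing D | ~~ right_handed v]|.

(** [s v = true] is the A-resolution of [v], [s v = false] the B-resolution. *)
Definition state : finType := {ffun crossing D -> bool}.

Definition numA (s : state) : nat := #|[pred v | s v]|.
Definition numB (s : state) : nat := #|[pred v | ~~ s v]|.
Definition sigma (s : state) : int := (numA s)%:Z - (numB s)%:Z.

(** The A-resolution creates no cusp, the B-resolution one right cusp and one
    left cusp; the cusps of the front itself survive in every state. *)
Definition state_cusps (s : state) : nat :=
  (front_cusps D + \sum_(v : crossing D) (if s v then 0%N else 2%N))%N.

Definition joined (s : state) (v : crossing D) (a b : arc D) : bool :=
  if s v
  then ([set a; b]%SET == [set nw v; ne v]%SET)
       || ([set a; b]%SET == [set sw v; se v]%SET)
  else ([set a; b]%SET == [set nw v; sw v]%SET)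
       || ([set a; b]%SET == [set ne v; se v]%SET).

(** A loop of a state is recorded as the set of arcs of the front on it. *)
Definition loops (s : state) : {set {set arc D}} :=
  equivalence_partition
    (connect [rel a b | [exists v, joined s v a b]]) [set: arc D]%SET.

Definition meets (L : {set arc D}) (v : crossing D) : bool :=
  [|| nw v \in L, ne v \in L, sw v \in L | se v \in L].

(** A labelling is recorded as the set of the loops labelled [+]. *)
Definition enhanced : finType :=
  {S : state * {set {set arc D}} | S.2 \subset loops S.1}.

Definition underlying (S : enhanced) : state := (val S).1.
Definition plus_loops (S : enhanced) : {set {set arc D}} := (val S).2.

Definition tau (S : enhanced) : int :=
  #|plus_loops S|%:Z - #|loops (underlying S) :\: plus_loops S|%:Z.

Definition igrading (S : enhanced) : rat :=
  (writhe - sigma (underlying S))%:~R / 2.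

Definition jgrading (S : enhanced) : rat :=
  (3 * writhe - sigma (underlying S) + 2 * tau S)%:~R / 2.

Definition kgrading (S : enhanced) : rat :=
  ((state_cusps (underlying S))%:Z - 2 * left_handed_crossings%:Z
     + 2 * tau S)%:~R / 2.

(** * The Legendrian Jones polynomial *)

(** [A] and [r] are arbitrary units of a commutative ring; formal variables
    are the case of a ring containing the Laurent polynomials in [A] and [r].
    The number of cusps of a closed front is even, so the division is exact. *)
Definition legendrian_jones (F : comUnitRingType) (A r : F) : F :=
  (- A) ^ (- (3 * writhe))
  * r ^ ((front_cusps D %/ 2)%N%:Z - left_handed_crossings%:Z)
  * \sum_(s : state) A ^ sigma s * r ^+ numB s
      * (- (A ^+ 2) * r^-1 - A ^- 2 * r) ^+ #|loops s|.

(** * The Legendrian Khovanov complex *)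

(** [t] is incident with [s], and they differ at [v]. *)
Definition incident_at (s t : state) (v : crossing D) : bool :=
  [&& s v, ~~ t v & [forall w, (w != v) ==> (s w == t w)]].

(** [enhanced_incident S T] : [T] is incident with [S]. *)
Definition enhanced_incident (S T : enhanced) : bool :=
  [&& jgrading S == jgrading T, kgrading S == kgrading T &
    [exists v, incident_at (underlying S) (underlying T) v &&
      [forall L in loops (underlying S) :&: loops (underlying T),
        ~~ meets L v ==> ((L \in plus_loops S) == (L \in plus_loops T))]]].

Definition chain : vectType 'F_2 := {ffun enhanced -> ('F_2)^o}.

Definition chain_basis (S : enhanced) : chain := [ffun T => (T == S)%:R].

Definition boundary : 'End(chain) :=
  linfun (fun u : chain => \sum_(S : enhanced)
    (u : {ffun enhanced -> ('F_2)^o}) S *: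
      \sum_(T : enhanced | enhanced_incident S T) chain_basis T).

Definition graded_chain (i k j : int) : {vspace chain} :=
  <<[seq chain_basis X | X in [pred X : enhanced |
      [&& igrading X == i%:~R, kgrading X == k%:~R & jgrading X == j%:~R]]]>>%VS.

(** The library has no quotient spaces: [(Z :\: B)%VS] is a complement in [Z]
    of [(Z :&: B)%VS], hence isomorphic to [Z / B] for [(B <= Z)%VS]. *)
Definition homology (i k j : int) : {vspace chain} :=
  ((lker boundary :&: graded_chain i k j)
     :\: (boundary @: graded_chain (i - 1) k j))%VS.

End States.

(** * Legendrian knots and their fronts *)

Local Open Scope classical_set_scope.

Definition smooth (R : realType) (f : R -> R) : Prop :=
  forall n t, derivable (derive1n n f) t 1.

(** The circle is [R / Z]; a smooth embedding of it is a smooth 1-periodic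
    immersion that is injective on a period. *)
Record legendrian_knot (R : realType) := LegendrianKnot {
  kx : R -> R;
  ky : R -> R;
  kz : R -> R;
  knot_smooth : [/\ smooth kx, smooth ky & smooth kz];
  knot_periodic : forall t,
    [/\ kx (t + 1) = kx t, ky (t + 1) = ky t & kz (t + 1) = kz t];
  knot_immersed : forall t,
    ~ [/\ derive1 kx t = 0, derive1 ky t = 0 & derive1 kz t = 0];
  knot_injective : forall s t, 0 <= s < 1 -> 0 <= t < 1 ->
    kx s = kx t -> ky s = ky t -> kz s = kz t -> s = t;
  knot_legendrian : forall t, derive1 kz t = ky t * derive1 kx t }.

Section Front.
Variables (R : realType) (K : legendrian_knot R).

Definition front (t : R) : R * R := (kx K t, kz K t).

Definition cusp_times : set R := [set t | 0 <= t < 1 /\ derive1 (kx K) t = 0].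

Definition left_cusp (t : R) : Prop :=
  [/\ derive1 (kx K) t = 0, \forall s \near t^'-, derive1 (kx K) s < 0
    & \forall s \near t^'+, 0 < derive1 (kx K) s].

Definition right_cusp (t : R) : Prop :=
  [/\ derive1 (kx K) t = 0, \forall s \near t^'-, 0 < derive1 (kx K) s
    & \forall s \near t^'+, derive1 (kx K) s < 0].

Definition crossing_times : set R :=
  [set t | 0 <= t < 1 /\ exists s, [/\ 0 <= s < 1, s != t & front s = front t]].

(** The determinant of the velocities of the front at [s] and at [t]. *)
Definition front_det (s t : R) : R :=
  derive1 (kx K) s * derive1 (kz K) t - derive1 (kz K) s * derive1 (kx K) t.

(** A zero of [kx'] at which [kx'] does not change sign would be a point where
    the front is neither smooth nor cusped. *)
Record generic_front : Prop := GenericFront {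
  generic_cusps : forall t, derive1 (kx K) t = 0 -> left_cusp t \/ right_cusp t;
  generic_finite_cusps : finite_set cusp_times;
  generic_finite_crossings : finite_set crossing_times;
  generic_transverse : forall s t, 0 <= s < 1 -> 0 <= t < 1 -> s != t ->
    front s = front t -> front_det s t != 0;
  generic_double : forall s t u, 0 <= s < 1 -> 0 <= t < 1 -> 0 <= u < 1 ->
    front s = front t -> front t = front u -> [|| s == t, t == u | s == u] }.

Definition slope (t : R) : R := derive1 (kz K) t / derive1 (kx K) t.

(** The times in [[0, 1)] at which the front passes through a crossing, in
    increasing order: two for each crossing. *)
Definition crossing_time_seq : seq R := sort <=%R (fset_set crossing_times).

(** Arc [i] goes from the [i]-th crossing time to the cyclically next one.  A
    front without crossings has one arc, the whole curve, and the value of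
    [arc_start] on it is irrelevant. *)
Definition knot_arc : finType := 'I_((size crossing_time_seq).-1.+1).

Definition arc_start (i : knot_arc) : R := nth 0 crossing_time_seq i.

(** A crossing is the pair of its strands, the over-strand (that of smaller
    slope) first; a strand is named by the arc that leaves the crossing on it. *)
Definition knot_crossing : finType :=
  {p : knot_arc * knot_arc |
    (front (arc_start p.1) == front (arc_start p.2))
    && (slope (arc_start p.1) < slope (arc_start p.2))}.

Definition over (v : knot_crossing) : knot_arc := (val v).1.
Definition under (v : knot_crossing) : knot_arc := (val v).2.

(** The arcs arriving at and leaving the start of arc [i] are [ord_pred i] and
    [i]; the former lies to the west when the front moves to the right there. *)
Definition west (i : knot_arc) : knot_arc :=
  if 0 < derive1 (kx K) (arc_start i) then ord_pred i else i.
Definition east (i : knot_arc) : knot_arc :=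
  if 0 < derive1 (kx K) (arc_start i) then i else ord_pred i.

(** The strand of smaller slope runs from NW to SE, the other from SW to NE. *)
Definition front_diagram : diagram := {|
  arc := knot_arc;
  crossing := knot_crossing;
  nw := fun v => west (over v);
  ne := fun v => east (under v);
  sw := fun v => west (under v);
  se := fun v => east (over v);
  right_handed :=
    fun v => 0 < front_det (arc_start (over v)) (arc_start (under v));
  front_cusps := #|` fset_set cusp_times|%fset |}.

End Front.

(* Main.v *)
(** The complex is the Khovanov complex of the front with coefficients in
    [F_2]: with [q = - A^-2], both the [j]- and the [k]-condition on incident
    enhanced states amount to [tau S = tau T + 1].  Once the differential
    squares to zero, the ranks of the differentials cancel from the Euler
    characteristic, which becomes a sum over enhanced states; summing over the
    labels of each state turns [(q r)^tau] into a power of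
    [- A^2 r^-1 - A^-2 r].

    Planarity of the front is not needed for the differential to square to zero.
    It suffices that every arc has an even number of its ends at crossings: by
    parity, changing the resolution of one crossing merges two loops, splits a
    loop, or leaves the set of loops unchanged, and in the last case no enhanced
    states are incident.  With coefficients in [F_2] the square of the
    differential vanishes for any such diagram.

    The gradings of enhanced states are integers because the number of cusps is
    even: [x'] is continuous and periodic and changes sign at each cusp. *)

From HB Require Import structures.
From mathcomp Require Import all_boot all_order all_algebra zify ring.
Require Import Defs.

Set Implicit Arguments.
Unset Strict Implicit.
Unset Printing Implicit Defensive.

Import Order.TTheory GRing.Theory Num.Theory.

Local Open Scope ring_scope.

(** * Merging two classes of an equivalence relation *)

Section Classes.
Variable T : finType.
Implicit Types (E : rel T) (x y z a b c : T) (A : {set T}) (p q : {set {set T}}).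

Definition is_equiv E := [/\ reflexive E, symmetric E & transitive E].

(** For an equivalence [E], this is the equivalence generated by [E] and the pair [(x, y)]. *)
Definition merge_rel E x y : rel T :=
  [rel a b | [|| E a b, E a x && E y b | E a y && E x b]].

Lemma merge_relC E x y : merge_rel E x y =2 merge_rel E y x.
Proof. by move=> a b; rewrite /merge_rel /= [X in _ || X]orbC. Qed.

Lemma merge_rel_equiv E x y : is_equiv E -> is_equiv (merge_rel E x y).
Proof.
case=> Er Es Et; split=> [a|a b|b a c]; first by rewrite /merge_rel /= Er.
  rewrite /merge_rel /= (Es a b) (Es a x) (Es y b) (Es a y) (Es x b).
  by congr (_ || _); rewrite orbC; congr (_ || _); rewrite andbC.
rewrite /merge_rel /= => /or3P[ab|/andP[ax yb]|/andP[ay xb]]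
  /or3P[bc|/andP[bx yc]|/andP[b_y xc]].
- by rewrite (Et b a c).
- by rewrite (Et b a x) ?yc ?orbT.
- by rewrite (Et b a y) ?xc ?orbT.
- by rewrite ax (Et b y c) ?orbT.
- by rewrite ax yc ?orbT.
- by rewrite (Et x a c).
- by rewrite ay (Et b x c) ?orbT.
- by rewrite (Et y a c).
- by rewrite ay xc ?orbT.
Qed.

Definition eqv_class E a : {set T} := [set b | E a b].

Definition classes E : {set {set T}} := [set eqv_class E a | a : T].

Lemma eqv_class_eq E a b :
  is_equiv E -> (eqv_class E a == eqv_class E b) = E a b.
Proof.
case=> Er Es Et; apply/eqP/idP => [/setP/(_ b)|ab]; first by rewrite !inE Er.
by apply/setP=> c; rewrite !inE; apply/idP/idP; apply: Et; rewrite // Es.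
Qed.

Lemma eq_classes E E' : E =2 E' -> classes E = classes E'.
Proof. by move=> eqE; apply: eq_imset => a; apply/setP=> b; rewrite !inE eqE. Qed.

(** In the algebra described at [marking], [A] is a set of omitted variables; the monomials of a
    labelled state omit at most one variable from each loop. *)
Definition separated E A : bool :=
  [forall a in A, forall b in A, E a b ==> (a == b)].

Lemma separatedP E A :
  reflect {in A &, forall a b, E a b -> a = b} (separated E A).
Proof.
apply: (iffP forall_inP) => [sep a b aA bA ab|sep a aA].
  by have /forall_inP/(_ b bA)/implyP/(_ ab)/eqP := sep a aA.
by apply/forall_inP=> b bA; apply/implyP=> /(sep _ _ aA bA) ->.
Qed.

(** For a separated [A], the loops that carry the label [+] in the labelled state whose image
    contains the monomial omitting [A]. *)
Definition hit_classes E A : {set {set T}} :=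
  [set L in classes E | L :&: A != set0].

Lemma mem_hit_classes E A a :
  (eqv_class E a \in hit_classes E A) = [exists b in A, E a b].
Proof.
rewrite inE imset_f //=; apply/set0Pn/exists_inP => [[b]|[b bA ab]].
  by rewrite !inE => /andP[ab bA]; exists b.
by exists b; rewrite !inE ab.
Qed.

Lemma eq_hit_classes E E' A : E =2 E' -> hit_classes E A = hit_classes E' A.
Proof. by move=> eqE; rewrite /hit_classes (eq_classes eqE). Qed.

(** Labelled states with loops [classes E] embed into the algebra generated by
    variables [x_a] with [x_a ^ 2 = 0], where the function [f] on sets stands for
    the sum of [f A] times the product of the [x_a] with [a \notin A]: a loop
    labelled [-] goes to the product of its variables, a loop labelled [+] to the
    sum of the products omitting one of them.  In this picture [add_pt c] is
    multiplication by [x_c], merging the loops of [x] and [y] is multiplication by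
    [x_x + x_y], and splitting a loop is an inclusion ([merge_marking] and
    [split_marking] below). *)
Definition marking (V : nmodType) E (g : {set {set T}} -> V) A : V :=
  if separated E A then g (hit_classes E A) else 0.

Definition add_pt (V : nmodType) c (f : {set T} -> V) A : V :=
  if c \in A then 0 else f (c |: A).

Section Merge.
Variables (E E' : rel T) (x y : T).
Hypotheses (eqvE : is_equiv E) (E'E : E' =2 merge_rel E x y) (xy : ~~ E x y).

Let eqvE' : is_equiv E'.
Proof.
case: (merge_rel_equiv x y eqvE) => Er Es Et; split=> [a|a b|b a c].
- by rewrite E'E Er.
- by rewrite !E'E Es.
- by rewrite !E'E; apply: Et.
Qed.

Let Er : reflexive E. Proof. by case: eqvE. Qed.
Let Es : symmetric E. Proof. by case: eqvE. Qed.
Let Et : transitive E. Proof. by case: eqvE. Qed.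
Let Er' : reflexive E'. Proof. by case: eqvE'. Qed.
Let Es' : symmetric E'. Proof. by case: eqvE'. Qed.
Let Et' : transitive E'. Proof. by case: eqvE'. Qed.

(** [X] and [Y] are the classes that merge, [Z] is the result, and [C] collects the classes that the
    merge leaves alone. *)
Let X := eqv_class E x.
Let Y := eqv_class E y.
Let Z := eqv_class E' x.
Let C := classes E :&: classes E'.

Lemma merge_rel_xE a : E' x a = E x a || E y a.
Proof.
by rewrite E'E /merge_rel /= Er (negPf xy) orbF.
Qed.

Lemma merge_rel_outE a : ~~ E' x a -> eqv_class E' a = eqv_class E a.
Proof.
rewrite merge_rel_xE negb_or => /andP[xa ya]; apply/setP=> b.
by rewrite !inE E'E /merge_rel /= (Es a x) (Es a y) (negPf xa) (negPf ya) orbF.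
Qed.

(** A class of [E'] that meets [Z] contains both [x] and [y], so it cannot be a class of [E], where
    the two points lie apart. *)
Lemma common_classP L :
  reflect (exists2 a, ~~ E' x a & L = eqv_class E a) (L \in C).
Proof.
apply: (iffP idP) => [|[a xa ->]]; last first.
  by rewrite inE imset_f //= -merge_rel_outE // imset_f.
rewrite inE => /andP[/imsetP[a _ ->] /imsetP[b _ ab]]; exists a => //.
have ba : E' b a by have /setP/(_ a) := ab; rewrite !inE Er.
apply/negP=> xa; have xb : E' x b by apply: Et' xa _; rewrite Es'.
have /setP eqab := ab.
have Eax : E a x by have := eqab x; rewrite !inE Es' xb.
have Eay : E a y.
  have := eqab y; rewrite !inE => ->; rewrite Es'; apply: Et' xb.
  by rewrite Es' merge_rel_xE Er orbT.
by case/negP: xy; apply: Et Eay; rewrite Es.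
Qed.

Lemma fine_classes L : L \in classes E -> [\/ L = X, L = Y | L \in C].
Proof.
case/imsetP=> a _ ->; case xa: (E' x a).
  move: xa; rewrite merge_rel_xE => /orP[] xa; [constructor 1|constructor 2];
  by apply/esym/eqP; rewrite eqv_class_eq.
by constructor 3; apply/common_classP; exists a; rewrite ?xa.
Qed.

Lemma coarse_classes L : L \in classes E' -> L = Z \/ L \in C.
Proof.
case/imsetP=> a _ ->; case xa: (E' x a); [left|right].
  by apply/esym/eqP; rewrite eqv_class_eq.
by rewrite merge_rel_outE ?xa //; apply/common_classP; exists a; rewrite ?xa.
Qed.

Lemma classX_notin_common : X \notin C.
Proof.
apply/common_classP=> -[a xa /eqP]; rewrite eqv_class_eq // => ax.
by rewrite merge_rel_xE ax in xa.
Qed.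

Lemma classY_notin_common : Y \notin C.
Proof.
apply/common_classP=> -[a xa /eqP]; rewrite eqv_class_eq // => ax.
by rewrite merge_rel_xE ax orbT in xa.
Qed.

Lemma classZ_notin_common : Z \notin C.
Proof.
apply/common_classP=> -[a xa /setP/(_ a)]; rewrite !inE Er.
by rewrite (negPf xa).
Qed.

Lemma XneqY : X != Y. Proof. by rewrite eqv_class_eq. Qed.

(** Together with [card_coarse], this turns a comparison of numbers of [+] labels into one of the
    labels of [X], [Y] and [Z], as labels on [C] agree. *)
Lemma card_fine p : p \subset classes E ->
  #|p| = ((X \in p) + (Y \in p) + #|p :&: C|)%N.
Proof.
move=> /subsetP pE; rewrite (cardsD1 X) (cardsD1 Y (p :\ X)) !inE eq_sym XneqY /= addnA.
congr (_ + _)%N; apply: eq_card => L; rewrite ![in LHS]inE [in RHS]in_setI.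
apply/and3P/andP => [[LY LX Lp]|[Lp LC]]; split=> //.
- by case: (fine_classes (pE _ Lp)) => // LE; [rewrite LE eqxx in LX|rewrite LE eqxx in LY].
- by apply: contraNneq classY_notin_common => <-.
- by apply: contraNneq classX_notin_common => <-.
Qed.

Lemma card_coarse p : p \subset classes E' ->
  #|p| = ((Z \in p) + #|p :&: C|)%N.
Proof.
move=> /subsetP pE; rewrite (cardsD1 Z); congr (_ + _)%N.
apply: eq_card => L; rewrite in_setD1 in_setI.
apply/andP/andP => [[LZ Lp]|[Lp LC]]; split=> //.
- by case: (coarse_classes (pE _ Lp)) => // LE; rewrite LE eqxx in LZ.
- by apply: contraNneq classZ_notin_common => <-.
Qed.

Lemma card_classes_merge : #|classes E| = #|classes E'|.+1.
Proof.
have [XE YE ZE] : [/\ X \in classes E, Y \in classes E & Z \in classes E'].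
  by split; apply: imset_f.
rewrite card_fine // (@card_coarse (classes E')) // XE YE ZE /C.
by rewrite setIA setIid [in RHS]setIC -setIA setIid.
Qed.

Lemma hit_common A : {in C, hit_classes E A =i hit_classes E' A}.
Proof. by move=> L; rewrite inE => /andP[LE LE']; rewrite !inE LE LE'. Qed.

Definition agree p q := [forall L in C, (L \in p) == (L \in q)].

Lemma agreeP p q : reflect (p :&: C = q :&: C) (agree p q).
Proof.
apply: (iffP forall_inP) => [pq|/setP pq L LC]; last first.
  by have := pq L; rewrite 2!in_setI LC !andbT => ->.
by apply/setP=> L; rewrite 2!in_setI; case: (boolP (L \in C)) => [/pq/eqP->|]; rewrite ?andbF.
Qed.

Lemma fine_ext p q : p \subset classes E -> q \subset classes E ->
  (X \in p) = (X \in q) -> (Y \in p) = (Y \in q) -> agree p q -> p = q.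
Proof.
move=> /subsetP pE /subsetP qE pqX pqY /forall_inP pqC.
apply/setP=> L; case: (boolP (L \in classes E)) => [|LE].
  by case/fine_classes=> [->|->|/pqC/eqP].
by apply/idP/idP => [/pE|/qE]; rewrite (negPf LE).
Qed.

Lemma coarse_ext p q : p \subset classes E' -> q \subset classes E' ->
  (Z \in p) = (Z \in q) -> agree p q -> p = q.
Proof.
move=> /subsetP pE /subsetP qE pqX /forall_inP pqC.
apply/setP=> L; case: (boolP (L \in classes E')) => [|LE].
  by case/coarse_classes=> [->|/pqC/eqP].
by apply/idP/idP => [/pE|/qE]; rewrite (negPf LE).
Qed.

Lemma hit_fineX A : (X \in hit_classes E A) = [exists b in A, E x b].
Proof. exact: mem_hit_classes. Qed.

Lemma hit_fineY A : (Y \in hit_classes E A) = [exists b in A, E y b].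
Proof. exact: mem_hit_classes. Qed.

Lemma hit_coarseZ A : (Z \in hit_classes E' A) = [exists b in A, E' x b].
Proof. exact: mem_hit_classes. Qed.

Lemma hit_sub F A : hit_classes F A \subset classes F.
Proof. by apply/subsetP=> L; rewrite inE => /andP[]. Qed.

Lemma hit_add F A c : is_equiv F ->
  hit_classes F (c |: A) = eqv_class F c |: hit_classes F A.
Proof.
move=> eqvF; apply/setP=> L; rewrite in_setU1; apply/idP/idP.
  rewrite !inE => /andP[LF /set0Pn[b]]; rewrite !inE => /andP[bL /predU1P[bc|bA]].
    case/imsetP: LF bL => a _ ->; rewrite inE bc => ac.
    by rewrite eqv_class_eq // ac.
  by rewrite LF orbC; apply/orP; left; apply/set0Pn; exists b; rewrite inE bL.
case/predU1P=> [->|].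
  rewrite mem_hit_classes; apply/exists_inP; exists c; rewrite ?setU11 //.
  by case: eqvF.
rewrite !inE => /andP[-> /set0Pn[b]]; rewrite inE => /andP[bL bA].
by apply/set0Pn; exists b; rewrite !inE bL bA orbT.
Qed.

Lemma sub_merge : subrel E E'.
Proof. by move=> a b ab; rewrite E'E /merge_rel /= ab. Qed.

Lemma separated_fine A : separated E' A -> separated E A.
Proof.
move=> /separatedP sep; apply/separatedP=> a b aA bA /sub_merge; exact: sep.
Qed.

(** Here and in [split_cond], [p] labels the source and [q] the target. The cardinality conditions
    are what [tau S = tau U + 1] becomes when the number of loops drops or grows by one. *)
Definition merge_cond p q :=
  [&& p \subset classes E, #|p| == #|q|.+1 & agree p q].

Definition split_cond p q :=
  [&& p \subset classes E', #|p| == #|q| & agree p q].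

(** If [x \notin A] and [x |: A] is separated for [E], then [A] avoids the class of [x], so [E']
    agrees with [E] on [A] and [A] is separated for [E'] as well. *)
Lemma merge_markingN (V : nmodType) (g : {set {set T}} -> V) A :
  ~~ separated E' A -> add_pt x (marking E g) A = 0.
Proof.
move=> nsep; rewrite /add_pt; case: ifPn => // xA; rewrite /marking.
case: ifP => // /separatedP sep; case/separatedP: nsep => a b aA bA.
have inx c : c \in A -> c \in x |: A by rewrite !inE orbC => ->.
have xc c : c \in A -> ~~ E x c.
  move=> cA; apply/negP=> xc; case/negP: xA.
  by have -> : x = c by apply: sep xc; rewrite ?setU11 ?inx.
rewrite E'E /merge_rel /= (Es a x) (negPf (xc _ aA)) (negPf (xc _ bA)) andbF !orbF.
by apply: sep; apply: inx.
Qed.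

(** Here [Z] is labelled [+], which arises only from [+] on both [X] and [Y]. The term of [x]
    vanishes because [X] already has an omitted variable, and the term of [y] records the one
    source. *)
Lemma merge_marking_hit (V : nmodType) (g : {set {set T}} -> V) A z :
  separated E' A -> z \in A -> E x z ->
  \sum_(p | merge_cond p (hit_classes E' A)) g p =
    add_pt x (marking E g) A + add_pt y (marking E g) A.
Proof.
move=> sepA zA xz; have /separatedP sep := sepA.
have x0 : add_pt x (marking E g) A = 0.
  rewrite /add_pt; case: ifPn => // xA; rewrite /marking.
  case: ifP => // /separatedP sepx; case/negP: xA.
  by have -> : x = z by apply: sepx xz; rewrite !inE ?eqxx ?zA ?orbT.
have yA a : a \in A -> ~~ E y a.
  move=> aA; apply/negP=> ya; have az : a = z.
    by apply: sep => //; rewrite E'E /merge_rel /= (Es a y) ya xz !orbT.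
  by case/negP: xy; apply: Et xz _; rewrite Es -az.
have nyA : y \notin A by apply/negP=> /yA; rewrite Er.
have sepy : separated E (y |: A).
  apply/separatedP=> a b; rewrite !inE => /predU1P[->|aA] /predU1P[->|bA] //.
  - by rewrite (negPf (yA _ bA)).
  - by rewrite Es (negPf (yA _ aA)).
  - by move=> /sub_merge; apply: sep.
rewrite x0 add0r /add_pt (negPf nyA) /marking sepy (big_pred1 (hit_classes E (y |: A))) //.
have ZA : Z \in hit_classes E' A.
  by rewrite hit_coarseZ; apply/exists_inP; exists z; rewrite // merge_rel_xE xz.
have XA : X \in hit_classes E (y |: A).
  by rewrite hit_fineX; apply/exists_inP; exists z; rewrite // !inE zA orbT.
have YA : Y \in hit_classes E (y |: A).
  by rewrite hit_fineY; apply/exists_inP; exists y; rewrite ?setU11.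
have agA : hit_classes E (y |: A) :&: C = hit_classes E' A :&: C.
  apply/setP=> L; rewrite 2!in_setI; case: (boolP (L \in C)) => [LC|]; last by rewrite !andbF.
  rewrite !andbT hit_add // in_setU1 hit_common //.
  by case: eqP => // LY; have := classY_notin_common; rewrite /Y -LY LC.
move=> p; apply/idP/eqP => [/and3P[pE /eqP cp pq]|->].
  have := cp; rewrite (card_fine pE) (card_coarse (hit_sub _ _)) ZA.
  move/agreeP: (pq) => ->; move/eqP; rewrite -addSn eqn_add2r.
  case: (boolP (X \in p)); case: (boolP (Y \in p)) => Yp Xp // _.
  apply: fine_ext; rewrite ?hit_sub ?Xp ?Yp ?XA ?YA //.
  by apply/agreeP; rewrite agA; apply/agreeP.
rewrite /merge_cond; apply/and3P; split; [exact: hit_sub| |exact/agreeP].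
by rewrite (card_fine (hit_sub _ _)) (card_coarse (hit_sub _ _)) ZA XA YA agA.
Qed.

(** Here [Z] is labelled [-], which arises from opposite labels on [X] and [Y]; each of the two
    sources accounts for one summand on the right. *)
Lemma merge_marking_miss (V : nmodType) (g : {set {set T}} -> V) A :
  separated E' A -> {in A, forall a, ~~ E' x a} ->
  \sum_(p | merge_cond p (hit_classes E' A)) g p =
    add_pt x (marking E g) A + add_pt y (marking E g) A.
Proof.
move=> sepA xA; have /separatedP sep := sepA.
have EA c a : E' x c -> a \in A -> ~~ E c a.
  by move=> xc aA; apply: contra (xA _ aA) => /sub_merge; apply: Et'.
have Exx : E' x x by [].
have Exy : E' x y by rewrite merge_rel_xE Er orbT.
have nA c : E' x c -> c \notin A by move=> xc; apply/negP=> /(EA _ _ xc); rewrite Er.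
have sepc c : E' x c -> separated E (c |: A).
  move=> xc; apply/separatedP=> a b; rewrite !inE => /predU1P[->|aA] /predU1P[->|bA] //.
  - by rewrite (negPf (EA _ _ xc bA)).
  - by rewrite Es (negPf (EA _ _ xc aA)).
  - by move=> /sub_merge; apply: sep.
rewrite /add_pt !(negPf (nA _ _)) // /marking !sepc //.
have ZA : (Z \in hit_classes E' A) = false.
  by rewrite hit_coarseZ; apply/exists_inP=> -[a /xA/negPf->].
have XA : (X \in hit_classes E A) = false.
  by rewrite hit_fineX; apply/exists_inP=> -[a /(EA _ _ Exx)/negPf->].
have YA : (Y \in hit_classes E A) = false.
  by rewrite hit_fineY; apply/exists_inP=> -[a /(EA _ _ Exy)/negPf->].
have agc c : eqv_class E c \notin C ->
    hit_classes E (c |: A) :&: C = hit_classes E' A :&: C.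
  move=> nC; apply/setP=> L; rewrite 2!in_setI.
  case: (boolP (L \in C)) => [LC|]; last by rewrite !andbF.
  rewrite !andbT hit_add // in_setU1 hit_common //.
  by case: eqP => // LY; rewrite -LY LC in nC.
have XX : (X \in hit_classes E (x |: A)) && (Y \notin hit_classes E (x |: A)).
  by rewrite hit_add // !in_setU1 eqxx YA orbF eqv_class_eq // Es.
have YY : (Y \in hit_classes E (y |: A)) && (X \notin hit_classes E (y |: A)).
  by rewrite hit_add // !in_setU1 eqxx XA orbF eqv_class_eq.
have [/andP[X1 Y1] /andP[Y2 X2]] := (XX, YY).
have cond c : eqv_class E c \notin C -> ((X \in hit_classes E (c |: A)) +
    (Y \in hit_classes E (c |: A)) = 1)%N ->
    merge_cond (hit_classes E (c |: A)) (hit_classes E' A).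
  move=> /agc ag cc; rewrite /merge_cond hit_sub (card_fine (hit_sub _ _)).
  rewrite (card_coarse (hit_sub _ _)) ag cc ZA eqxx; exact/agreeP.
rewrite (bigD1 (hit_classes E (x |: A))) /=; last first.
  by apply: cond; rewrite ?classX_notin_common // X1 (negPf Y1).
congr (_ + _); apply: big_pred1 => p; apply/idP/eqP => [|->]; last first.
  rewrite cond ?classY_notin_common ?Y2 ?(negPf X2) //; apply: contraNneq X2 => ->.
  by rewrite X1.
case/andP=> /and3P[pE /eqP cp pq] px.
have := cp; rewrite (card_fine pE) (card_coarse (hit_sub _ _)) ZA.
move/agreeP: (pq) => ag; rewrite ag.
move/eqP; rewrite -addSn eqn_add2r.
case: (boolP (X \in p)); case: (boolP (Y \in p)) => Yp Xp // _.
  case/negP: px; apply/eqP; apply: fine_ext;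
    rewrite ?hit_sub ?Xp ?(negPf Yp) ?X1 ?(negPf Y1) //.
  by apply/agreeP; rewrite agc ?classX_notin_common.
apply: fine_ext; rewrite ?hit_sub ?Yp ?(negPf Xp) ?Y2 ?(negPf X2) //.
by apply/agreeP; rewrite agc ?classY_notin_common.
Qed.

(** The product of the variables of [Z] is that of [X] times that of [Y], and omitting one variable
    of [Z] means omitting one from [X] or one from [Y]. So a labelled loop and the sum of its
    splittings are the same element of the algebra. *)
Lemma split_marking (V : nmodType) (g : {set {set T}} -> V) A :
  marking E (fun q => \sum_(p | split_cond p q) g p) A = marking E' g A.
Proof.
rewrite {1}/marking; case: ifPn => [sepA|nsep]; last first.
  by rewrite /marking ifN //; apply: contra nsep; apply: separated_fine.
have agA : hit_classes E A :&: C = hit_classes E' A :&: C.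
  apply/setP=> L; rewrite 2!in_setI; case: (boolP (L \in C)) => [LC|]; last by rewrite !andbF.
  by rewrite hit_common.
rewrite /marking; case: ifPn => [sepA'|nsepA'].
  (* Separation for [E'] allows only one point of [A] on [Z], so [X] and [Y] are not both hit. *)
  have cZ : ((X \in hit_classes E A) + (Y \in hit_classes E A) = (Z \in hit_classes E' A))%N.
    rewrite hit_fineX hit_fineY hit_coarseZ.
    have -> : [exists b in A, E' x b] = [exists b in A, E x b] || [exists b in A, E y b].
      apply/exists_inP/orP => [[b bA]|[] /exists_inP[b bA xb]].
      - by rewrite merge_rel_xE => /orP[] xb; [left|right]; apply/exists_inP; exists b.
      - by exists b => //; rewrite merge_rel_xE xb.
      - by exists b => //; rewrite merge_rel_xE xb orbT.
    case: (boolP [exists b in A, E x b]); case: (boolP [exists b in A, E y b]) => //.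
    case/exists_inP=> b bA yb /exists_inP[a aA xa]; have ab : a = b.
      move/separatedP: sepA'; apply=> //; rewrite E'E /merge_rel /=.
      by rewrite (Es a x) xa yb orbT.
    by case/negP: xy; apply: Et xa _; rewrite ab Es.
  apply: big_pred1 => p; apply/idP/eqP => [/and3P[pE /eqP cp pq]|->].
    have := cp; rewrite (card_fine (hit_sub _ _)) (card_coarse pE) cZ.
    move/agreeP: (pq) => ag; rewrite ag => /addIn cnt.
    apply: coarse_ext; rewrite ?hit_sub //; last by apply/agreeP; rewrite ag.
    by move: cnt; do 2 case: (_ \in _).
  rewrite /split_cond hit_sub (card_fine (hit_sub _ _)) (card_coarse (hit_sub _ _)).
  by rewrite cZ agA eqxx; apply/agreeP.
(* Now [A] has a point on [X] and another on [Y]. The target then has two [+] labels off [C], the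
   source at most one, so no source exists. *)
apply: big_pred0 => p; apply/negP=> /and3P[pE /eqP cp pq].
have : (#|p| < #|hit_classes E A|)%N; last by rewrite cp ltnn.
rewrite (card_fine (hit_sub _ _)) (card_coarse pE); move/agreeP: (pq) => ->.
have XYA a b : a \in A -> b \in A -> E x a -> E y b ->
    (X \in hit_classes E A) && (Y \in hit_classes E A).
  move=> aA bA xa yb; rewrite hit_fineX hit_fineY.
  by apply/andP; split; apply/exists_inP; [exists a|exists b].
suff /andP[-> ->] : (X \in hit_classes E A) && (Y \in hit_classes E A)
  by rewrite ltn_add2r; case: (_ \in p).
move: nsepA'; rewrite negb_forall_in => /exists_inP[a aA].
rewrite negb_forall_in => /exists_inP[b bA]; rewrite negb_imply E'E /merge_rel /= => /andP[].
case/or3P=> [ab|/andP[ax yb] _|/andP[ay xb] _].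
- by move/separatedP: sepA => /(_ a b aA bA ab) ->; rewrite eqxx.
- by apply: (XYA a b); rewrite // Es.
- by apply: (XYA b a); rewrite // Es.
Qed.

End Merge.

Lemma merge_marking (E E' : rel T) x y (V : nmodType) (g : {set {set T}} -> V) A :
  is_equiv E -> E' =2 merge_rel E x y -> ~~ E x y ->
  marking E' (fun q => \sum_(p | merge_cond E E' p q) g p) A =
    add_pt x (marking E g) A + add_pt y (marking E g) A.
Proof.
move=> eqvE E'E xy; have [Er Es Et] := eqvE.
have E'E' : E' =2 merge_rel E y x by move=> a b; rewrite E'E merge_relC.
have yx : ~~ E y x by rewrite Es.
rewrite {1}/marking; case: ifPn => [sepA|nsep]; last first.
  by rewrite (merge_markingN eqvE E'E) // (merge_markingN eqvE E'E') // addr0.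
case: (boolP [exists a in A, E' x a]) => [/exists_inP[a aA]|].
  rewrite (merge_rel_xE eqvE E'E xy) => /orP[xa|ya].
    exact: (merge_marking_hit eqvE E'E xy _ sepA aA xa).
  by rewrite addrC (merge_marking_hit eqvE E'E' yx _ sepA aA ya).
rewrite negb_exists_in => /forall_inP xA; exact: merge_marking_miss.
Qed.

End Classes.

(** * Further properties of merges and of the embedding of labelled states *)

Section MergeMore.
Variable T : finType.
Implicit Types (E : rel T) (x y z a b c : T) (A : {set T}) (p q : {set {set T}}).

Lemma connect_min (e E : rel T) :
  is_equiv E -> subrel e E -> subrel (connect e) E.
Proof.
case=> Er _ Et eE a b /connectP[p + ->]; elim: p a => [|c p IH] a /=; first by rewrite Er.
by case/andP=> /eE ac /IH; apply: Et.
Qed.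

Lemma connect_equiv (e : rel T) : symmetric e -> is_equiv (connect e).
Proof.
move=> es; split; [exact: connect0| |exact: connect_trans].
exact: sym_connect_sym.
Qed.

Lemma merge_rel_id E x y : is_equiv E -> E x y -> merge_rel E x y =2 E.
Proof.
case=> Er Es Et xy a b; rewrite /merge_rel /=; apply/idP/idP => [|->] //.
case/or3P=> [//|/andP[ax yb]|/andP[ay xb]].
- by apply: (Et x) => //; apply: (Et y).

- by apply: (Et y) => //; apply: (Et x) => //; rewrite Es.
Qed.

Lemma eq_merge_rel E E' x y : E =2 E' -> merge_rel E x y =2 merge_rel E' x y.
Proof. by move=> eqE a b; rewrite /merge_rel /= !eqE. Qed.

Lemma merge_rel_congr E x y x' y' : is_equiv E -> E x x' -> E y y' ->
  merge_rel E x y =2 merge_rel E x' y'.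
Proof.
case=> Er Es Et xx' yy' a b; rewrite /merge_rel /=.
have cl c c' d : E c c' -> E c d = E c' d.
  by move=> cc'; apply/idP/idP; apply: Et; rewrite // Es.
rewrite (cl x x' b) // (cl y y' b) //.
by rewrite [E a x]Es (cl x x') // [E a y]Es (cl y y') // ![E _ a]Es.
Qed.

Lemma merge_relxy E x y : is_equiv E -> merge_rel E x y x y.
Proof. by case=> Er _ _; rewrite /merge_rel /= !Er orbT. Qed.

Lemma sub_merge_rel E x y : subrel E (merge_rel E x y).
Proof. by move=> a b ab; rewrite /merge_rel /= ab. Qed.

Lemma add_ptC (V : nmodType) c d (f : {set T} -> V) A :
  add_pt c (add_pt d f) A = add_pt d (add_pt c f) A.
Proof.
rewrite /add_pt !in_setU1 [d == c]eq_sym; case: (eqVneq c d) => [->//|_] /=.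
by do 2 case: ifP => // _; rewrite setUCA.
Qed.

Lemma eq_add_pt (V : nmodType) c (f g : {set T} -> V) A :
  f =1 g -> add_pt c f A = add_pt c g A.
Proof. by move=> fg; rewrite /add_pt fg. Qed.

Lemma add_ptD (V : nmodType) c (f g : {set T} -> V) A :
  add_pt c (fun B => f B + g B) A = add_pt c f A + add_pt c g A.
Proof. by rewrite /add_pt; case: ifP => //; rewrite addr0. Qed.

Lemma eq_marking (V : nmodType) E E' (g h : {set {set T}} -> V) A :
  E =2 E' -> (forall p, p \subset classes E -> g p = h p) ->
  marking E g A = marking E' h A.
Proof.
move=> eqE gh; rewrite /marking -(eq_hit_classes _ eqE) gh ?hit_sub //.
congr (if _ then _ else _); apply: eq_forallb => a; congr (_ ==> _).
by apply: eq_forallb => b; rewrite eqE.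
Qed.

(** Multiplication by any variable of a loop has the same effect: it kills the label [-] and turns
    the label [+] into [-]. *)
Lemma add_pt_marking (V : nmodType) E (g : {set {set T}} -> V) a b A :
  is_equiv E -> E a b -> add_pt a (marking E g) A = add_pt b (marking E g) A.
Proof.
move=> eqvE ab; have [Er Es Et] := eqvE.
case: (eqVneq a b) => [->//|nab].
have nsep c d : c != d -> E c d -> d \in A -> separated E (c |: A) = false.
  move=> ncd cd dA; apply/negP=> /separatedP sep; case/eqP: ncd.
  by apply: sep cd; rewrite !inE ?eqxx ?dA ?orbT.
have ba : E b a by rewrite Es.
have nba : b != a by rewrite eq_sym.
rewrite /add_pt; case: (boolP (a \in A)); case: (boolP (b \in A)) => bA aA //.
- by rewrite /marking (nsep b a).
- by rewrite /marking (nsep a b).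
have sepW c d : E c d -> c \notin A -> separated E (c |: A) -> separated E (d |: A).
  move=> cd cA /separatedP sep.
  have dA x : x \in A -> E d x -> False.
    move=> xA dx; case/negP: cA; have -> : c = x; last by [].
    by apply: sep; rewrite ?setU11 // ?inE ?xA ?orbT //; apply: Et cd dx.
  apply/separatedP=> x y; rewrite !inE => /predU1P[->|xA] /predU1P[->|yA] xy //.
  - by case: (dA _ yA xy).
  - by case: (dA _ xA); rewrite Es.
  - by apply: sep xy; rewrite !inE ?xA ?yA orbT.
rewrite /marking.
have -> : separated E (a |: A) = separated E (b |: A)
  by apply/idP/idP; apply: sepW.
rewrite !hit_add //; case: ifP => // _.
by have /eqP-> : eqv_class E a == eqv_class E b by rewrite eqv_class_eq.
Qed.

(** Since [pick] depends on a loop only as a set, it selects one point on each loop of [p]. This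
    makes every labelling visible to [marking]. *)
Lemma section_ex E p : is_equiv E -> p \subset classes E ->
  exists2 A, separated E A & hit_classes E A = p.
Proof.
move=> eqvE /subsetP pE; have [Er Es Et] := eqvE.
pose A := [set a | (eqv_class E a \in p) && ([pick b in eqv_class E a] == Some a)].
exists A; first apply/separatedP=> a b.
  rewrite !inE => /andP[_ /eqP pa] /andP[_ /eqP pb] ab.
  have /eqP cab : eqv_class E a == eqv_class E b by rewrite eqv_class_eq.
  by move: pa; rewrite cab pb => -[].
apply/setP=> L; apply/idP/idP => [|Lp].
  rewrite inE => /andP[/imsetP[c _ ->] /set0Pn[a]].
  rewrite in_setI !inE => /andP[ca /andP[ap _]].
  by have /eqP-> : eqv_class E c == eqv_class E a by rewrite eqv_class_eq.
have /imsetP[c _ Lc] := pE _ Lp; rewrite Lc mem_hit_classes; apply/exists_inP.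
case pickc: [pick b in eqv_class E c] => [a|]; last first.
  by move: pickc; case: pickP => // /(_ c); rewrite inE Er.
have ca : E c a by move: pickc; case: pickP => // b; rewrite inE => cb [<-].
have /eqP cca : eqv_class E c == eqv_class E a by rewrite eqv_class_eq.
by exists a => //; rewrite inE -cca -Lc Lp Lc pickc eqxx.
Qed.

End MergeMore.

(** * Resolving a crossing *)

Section EvenDiagram.
Variable D : diagram.
Implicit Types (s t : state D) (v w : crossing D) (a b : Defs.arc D).

Definition ends_in (X : {pred Defs.arc D}) v : nat :=
  ((nw v \in X) + (ne v \in X) + (sw v \in X) + (se v \in X))%N.

Definition even_diagram :=
  forall a, ~~ odd (\sum_(v : crossing D) ends_in (pred1 a) v).

Definition eqv s : rel (Defs.arc D) :=
  connect [rel a b | [exists v, joined s v a b]].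

(** The connections made by the rest of the state when [v] is left unresolved; both resolutions of
    [v] are compared over it. *)
Definition outer s v : rel (Defs.arc D) :=
  connect [rel a b | [exists w, (w != v) && joined s w a b]].

Lemma set2_eq (T : finType) (a b c d : T) :
  ([set a; b] == [set c; d]) = (a == c) && (b == d) || (a == d) && (b == c).
Proof.
apply/eqP/orP => [/setP eqS|[] /andP[/eqP-> /eqP->] //]; last by rewrite setUC.
have := (eqS a, eqS b, eqS c, eqS d); rewrite !inE !eqxx /= !orbT.
move=> [[[/esym/orP[]/eqP ac /esym/orP[]/eqP bc]]]; subst; rewrite ?eqxx ?orbT ?andbT /=;
  by rewrite ?orbb ?orbF ?(eq_sym d c); auto.
Qed.

Lemma joinedC s v a b : joined s v a b = joined s v b a.
Proof. by rewrite /joined setUC. Qed.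

Lemma eqv_equiv s : is_equiv (eqv s).
Proof.
by apply: connect_equiv => a b /=; apply: eq_existsb => v; rewrite joinedC.
Qed.

Lemma outer_equiv s v : is_equiv (outer s v).
Proof.
by apply: connect_equiv => a b /=; apply: eq_existsb => w; rewrite joinedC.
Qed.

Lemma loopsE s : loops s = classes (eqv s).
Proof.
rewrite /loops /equivalence_partition /classes.
have -> : [set: Defs.arc D] = [set x in predT] by apply/setP=> a; rewrite !inE.
apply/setP=> L; apply/imsetP/imsetP => -[a _ ->]; exists a => //;
  by rewrite ?inE //; apply/setP=> b; rewrite !inE.
Qed.

Lemma eq_outer s t v : (forall w, w != v -> s w = t w) -> outer s v =2 outer t v.
Proof.
move=> st; apply: eq_connect => a b /=; apply: eq_existsb => w.
by case: eqP => //= /eqP wv; rewrite /joined st.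
Qed.

Lemma joined_sub_merge (E : rel (Defs.arc D)) a b c d : is_equiv E -> E c d ->
  ([set a; b] == [set c; d]) -> E a b.
Proof.
case=> _ Es _ cd; rewrite set2_eq => /orP[]/andP[/eqP-> /eqP->] //.
by rewrite Es.
Qed.

Lemma eqv_joined s v a b : joined s v a b -> eqv s a b.
Proof. by move=> vab; apply: connect1; apply/existsP; exists v. Qed.

Lemma eqv_A s v : s v -> eqv s (nw v) (ne v) /\ eqv s (sw v) (se v).
Proof.
by move=> sv; split; apply: (@eqv_joined _ v); rewrite /joined sv !eqxx ?orbT.
Qed.

Lemma eqv_B s v : ~~ s v -> eqv s (nw v) (sw v) /\ eqv s (ne v) (se v).
Proof.
by move=> /negPf sv; split; apply: (@eqv_joined _ v); rewrite /joined sv !eqxx ?orbT.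
Qed.

Lemma outer_sub s v : subrel (outer s v) (eqv s).
Proof.
apply: connect_sub => a b /existsP[w /andP[_ wab]].
exact: (eqv_joined wab).
Qed.

Lemma merge_rel_sub (T : finType) (E E' : rel T) x y :
  is_equiv E' -> subrel E E' -> E' x y -> subrel (merge_rel E x y) E'.
Proof.
case=> _ Es Et EE' xy a b /or3P[/EE'//|/andP[/EE' ax /EE' yb]|/andP[/EE' ay /EE' xb]].
  by apply: (Et y) => //; apply: (Et x).
by apply: (Et x) => //; apply: (Et y); rewrite // Es.
Qed.

Lemma eqv_split s v (x y z t : Defs.arc D) :
  (forall a b, joined s v a b =
     ([set a; b] == [set x; y]) || ([set a; b] == [set z; t])) ->
  eqv s =2 merge_rel (merge_rel (outer s v) x y) z t.
Proof.
move=> jE a b.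
have eqvM1 := merge_rel_equiv x y (outer_equiv s v).
have eqvM := merge_rel_equiv z t eqvM1.
have [xy zt] : eqv s x y /\ eqv s z t.
  by split; apply: (@eqv_joined _ v); rewrite jE eqxx ?orbT.
apply/idP/idP; last first.
  by do 2 (apply: merge_rel_sub => //; try exact: eqv_equiv); exact: outer_sub.
apply: connect_min => // {}a {}b /existsP[w wab]; case: (eqVneq w v) => [wv|wv].
  move: wab; rewrite wv jE => /orP[].
    apply: joined_sub_merge => //; apply: sub_merge_rel.
    exact: merge_relxy (outer_equiv s v).
  by apply: joined_sub_merge => //; apply: merge_relxy.
do 2 apply: sub_merge_rel; apply: connect1; apply/existsP; exists w.
by rewrite wv.
Qed.

Hypothesis evenD : even_diagram.

(** Over all crossings, the arcs of [X] have an even number of ends in total. At a crossing other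
    than [v] the resolution joins the ends in pairs that lie in [X] together, so an even number is
    left for [v]. *)
Lemma even_ends (X : {set Defs.arc D}) s v :
  (forall a b, outer s v a b -> (a \in X) = (b \in X)) -> ~~ odd (ends_in (mem X) v).
Proof.
move=> closX.
have total : ~~ odd (\sum_w ends_in (mem X) w).
  have -> : (\sum_w ends_in (mem X) w = \sum_(a in X) \sum_w ends_in (pred1 a) w)%N.
    rewrite exchange_big; apply: eq_bigr => w _; rewrite /ends_in !big_split /=.
    have sum1 b : ((b \in X) = \sum_(a in X) (b == a) :> nat)%N.
      case: (boolP (b \in X)) => bX.
        by rewrite (bigD1 b) //= eqxx big1 // => a /andP[_ /negPf]; rewrite eq_sym => ->.
      by rewrite big1 // => a aX; case: eqP => // ba; rewrite ba aX in bX.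
    by rewrite !sum1.
  by elim/big_ind: _ => // m n; rewrite oddD => /negPf-> /negPf->.
move: total; rewrite (bigD1 v) //= oddD.
have /negPf-> : ~~ odd (\sum_(w | w != v) ends_in (mem X) w).
  elim/big_ind: _ => // [m n|w wv]; first by rewrite oddD => /negPf-> /negPf->.
  have out a b : joined s w a b -> (a \in X) = (b \in X).
    move=> wab; apply: closX; apply: connect1; apply/existsP; exists w.
    by rewrite wv.
  rewrite /ends_in /= !oddD !oddb; case: (boolP (s w)) => sw.
    rewrite (out (nw w) (ne w)); last by rewrite /joined sw eqxx.
    rewrite (out (Defs.sw w) (se w)); last by rewrite /joined sw eqxx orbT.
    by rewrite addbb addbK.
  rewrite (out (nw w) (Defs.sw w)); last by rewrite /joined (negPf sw) eqxx.
  rewrite (out (ne w) (se w)); last by rewrite /joined (negPf sw) eqxx orbT.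
  by do 2 case: (_ \in X).
by rewrite addbF.
Qed.

(** The cases correspond to the way the rest of the state connects the four ends
    at [v]: NW to NE and SW to SE; NW to SW and NE to SE; and in the last case NW
    to SE and NE to SW, or all four ends together. *)
Variant step_spec s t v : Prop :=
  | StepMerge of ~~ eqv s (nw v) (sw v) & eqv t (nw v) (ne v)
      & eqv t =2 merge_rel (eqv s) (nw v) (sw v)
  | StepSplit of eqv s (nw v) (sw v) & ~~ eqv t (nw v) (ne v)
      & eqv s =2 merge_rel (eqv t) (nw v) (ne v)
  | StepSame of eqv s (nw v) (sw v) & eqv t (nw v) (ne v) & eqv t =2 eqv s.

Lemma stepP s t v : incident_at s t v -> step_spec s t v.
Proof.
case/and3P=> sv tv /forallP st.
have {}st w : w != v -> s w = t w by move=> wv; apply/eqP; have := st w; rewrite wv.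
set O := outer s v.
have eqvO : is_equiv O := outer_equiv s v; have [Or Os Ot] := eqvO.
have OE := eq_outer st.
have sE : eqv s =2 merge_rel (merge_rel O (nw v) (ne v)) (sw v) (se v).
  by apply: eqv_split => a b; rewrite /joined sv.
have tE : eqv t =2 merge_rel (merge_rel O (nw v) (sw v)) (ne v) (se v).
  move=> a b; rewrite (@eqv_split t v (nw v) (sw v) (ne v) (se v)); last first.
    by move=> c d; rewrite /joined (negPf tv).
  by do 2 apply: eq_merge_rel => {a b} a b; rewrite -OE.
have odd_class a : ~~ odd (ends_in (O a) v).
  have := @even_ends (eqv_class O a) s v; rewrite /ends_in !inE; apply=> b c bc.
  by rewrite !inE; apply/idP/idP => /Ot; apply; rewrite // Os.
have := (odd_class (nw v), odd_class (ne v), odd_class (sw v)).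
rewrite /ends_in /in_mem /= !Or.
have M12 x y z u : O x y -> O z u -> merge_rel (merge_rel O x y) z u =2 O.
  move=> xy zu a b; rewrite (merge_rel_id (merge_rel_equiv _ _ eqvO)).
    exact: merge_rel_id.
  exact: sub_merge_rel.
have M1 x y z u : O x z -> O y u -> merge_rel (merge_rel O x y) z u =2 merge_rel O x y.
  move=> xz yu a b; have eqvM := merge_rel_equiv x y eqvO.
  have [_ Ms Mt] := eqvM.
  rewrite merge_rel_id //; apply: (Mt x); first by rewrite Ms; apply: sub_merge_rel.
  by apply: (Mt y); [apply: merge_relxy|apply: sub_merge_rel].
have Oc a b c : O a b -> O c a = O c b.
  by move=> ab; apply/idP/idP => /Ot; apply; rewrite // Os.
move=> [[H1 H2] H3].
(* By parity the classes of [O] cut the four ends into blocks of even size: one block, or two pairs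
   in one of three ways. *)
have [[nn ns nse]|[nn ns sse]|[ns nn nse]|[nse nn ns nes]] :
    [\/ [/\ O (nw v) (ne v), O (nw v) (sw v) & O (nw v) (se v)],
        [/\ O (nw v) (ne v), ~~ O (nw v) (sw v) & O (sw v) (se v)],
        [/\ O (nw v) (sw v), ~~ O (nw v) (ne v) & O (ne v) (se v)] |
        [/\ O (nw v) (se v), ~~ O (nw v) (ne v), ~~ O (nw v) (sw v) & O (ne v) (sw v)]].
  move: H1 H2 H3; case nn: (O (nw v) (ne v)).
    rewrite -(Oc _ _ (sw v) nn) (Os (sw v) (nw v)).
    by case ns: (O (nw v) (sw v)); case: (O (nw v) (se v)); case: (O (sw v) (se v)) => // _ _ _;
      constructor.
  rewrite (Os (ne v) (nw v)) nn; case ns: (O (nw v) (sw v)).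
    rewrite -(Oc _ _ (ne v) ns) (Os (ne v) (nw v)) nn.
    by case: (O (nw v) (se v)) => //= _; case nse: (O (ne v) (se v)) => // _ _; constructor.
  case nse: (O (nw v) (se v)) => //= _.
  rewrite -(Oc _ _ (ne v) nse) (Os (ne v) (nw v)) nn.
  by case nes: (O (ne v) (sw v)) => // _ _; constructor.
- have sO : eqv s =2 O.
    by move=> a b; rewrite sE M12 // -(Oc (nw v)) // Os.
  have tO : eqv t =2 O.
    by move=> a b; rewrite tE M12 // -(Oc (nw v)) // Os.
  by apply: StepSame; rewrite ?sO ?tO // => a b; rewrite sO tO.
- have sO : eqv s =2 O by move=> a b; rewrite sE M12.
  have tO : eqv t =2 merge_rel O (nw v) (sw v) by move=> a b; rewrite tE M1.
  apply: StepMerge; rewrite ?sO ?tO //.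
    exact: sub_merge_rel.
  by move=> a b; rewrite tO; apply: eq_merge_rel => {a b} a b; rewrite sO.
- have tO : eqv t =2 O by move=> a b; rewrite tE M12.
  have sO : eqv s =2 merge_rel O (nw v) (ne v) by move=> a b; rewrite sE M1.
  apply: StepSplit; rewrite ?sO ?tO //.
    exact: sub_merge_rel.
  by move=> a b; rewrite sO; apply: eq_merge_rel => {a b} a b; rewrite tO.
(* With opposite ends connected outside [v], either resolution joins all four ends. *)
- have M1' x y z u : O x u -> O y z -> merge_rel (merge_rel O x y) z u =2 merge_rel O x y.
    by move=> xu yz a b; rewrite merge_relC; apply: M1.
  have sO : eqv s =2 merge_rel O (nw v) (ne v) by move=> a b; rewrite sE M1'.
  have tO : eqv t =2 merge_rel O (nw v) (ne v).
    move=> a b; rewrite tE M1' // 1?Os //; apply: merge_rel_congr; rewrite ?Or //.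
    by rewrite Os.
  apply: StepSame; rewrite ?sO ?tO.
  - by rewrite /merge_rel /= Or nes orbT.
  - exact: merge_relxy.
  - by move=> a b; rewrite sO tO.
Qed.

End EvenDiagram.

(** * Enhanced states and the component of the differential at one crossing *)

Section Enhanced.
Variable D : diagram.
Implicit Types (s t : state D) (v w : crossing D) (a b : Defs.arc D).
Implicit Types (S U : enhanced D) (p q : {set {set Defs.arc D}}).

Lemma numA_incident s t v : incident_at s t v -> numA s = (numA t).+1.
Proof.
case/and3P=> sv tv /forallP st; rewrite /numA (cardD1 v) inE /= sv add1n; congr _.+1.
apply: eq_card => w; rewrite !inE; have := st w.
by case: (eqVneq w v) => [->|_ /eqP->]; rewrite //= (negPf tv).
Qed.

Lemma numB_incident s t v : incident_at s t v -> numB t = (numB s).+1.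
Proof.
case/and3P=> sv tv /forallP st; rewrite /numB (cardD1 v) inE /= tv add1n; congr _.+1.
apply: eq_card => w; rewrite !inE; have := st w.
by case: (eqVneq w v) => [->|_ /eqP->]; rewrite //= sv.
Qed.

Lemma sigma_incident s t v : incident_at s t v -> sigma s = sigma t + 2.
Proof.
by move=> st; rewrite /sigma (numA_incident st) (numB_incident st) !intS; ring.
Qed.

Lemma state_cuspsE s : state_cusps s = (front_cusps D + 2 * numB s)%N.
Proof.
rewrite /state_cusps /numB mulnC -sum_nat_const; congr addn.
by rewrite [RHS]big_mkcond; apply: eq_bigr => v _; rewrite inE; case: (s v).
Qed.

Lemma plus_loops_sub S : plus_loops S \subset loops (underlying S).
Proof. exact: valP S. Qed.

Lemma tauE S : tau S = 2 * #|plus_loops S|%:Z - #|loops (underlying S)|%:Z.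
Proof.
rewrite /tau cardsDS ?plus_loops_sub // -subzn ?subset_leq_card ?plus_loops_sub //.
ring.
Qed.

Lemma half_eq (x y : int) : (x%:~R / 2 == y%:~R / 2 :> rat) = (x == y).
Proof. by rewrite (inj_eq (divIf _)) ?eqr_int. Qed.

Lemma jgrading_incident S U v : incident_at (underlying S) (underlying U) v ->
  (jgrading S == jgrading U) = (tau S == tau U + 1).
Proof.
move=> st; rewrite half_eq (sigma_incident st); apply/eqP/eqP; lia.
Qed.

Lemma kgrading_incident S U v : incident_at (underlying S) (underlying U) v ->
  (kgrading S == kgrading U) = (tau S == tau U + 1).
Proof.
move=> st; rewrite half_eq !state_cuspsE (numB_incident st); apply/eqP/eqP; lia.
Qed.

Definition common_agree v S U :=
  [forall L in loops (underlying S) :&: loops (underlying U),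
        ~~ Defs.meets L v ==> ((L \in plus_loops S) == (L \in plus_loops U))].

(** The incidences at the single crossing [v], with both grading conditions replaced by the
    condition on [tau] to which they amount. *)
Definition flow v S U :=
  [&& incident_at (underlying S) (underlying U) v, tau S == tau U + 1
    & common_agree v S U].

Lemma incident_uniq s t v w : incident_at s t v -> incident_at s t w -> v = w.
Proof.
case/and3P=> sv tv _ /and3P[_ _ /forallP/(_ v)]; rewrite sv (negPf tv).
by case: eqP.
Qed.

Lemma enhanced_incidentE S U : enhanced_incident S U = [exists v, flow v S U].
Proof.
apply/and3P/existsP => [[j k /existsP[v /andP[st ag]]]|[v /and3P[st tSU ag]]].
  by exists v; rewrite /flow /common_agree st ag -(jgrading_incident st) j.
split; rewrite ?(jgrading_incident st) ?(kgrading_incident st) //.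
by apply/existsP; exists v; rewrite st.
Qed.

Lemma incident_sumE (V : nmodType) (f : enhanced D -> V) U :
  \sum_(S | enhanced_incident S U) f S = \sum_v \sum_(S | flow v S U) f S.
Proof.
rewrite (exchange_big_dep (fun S => enhanced_incident S U)) /=; last first.
  by move=> v S _ vSU; rewrite enhanced_incidentE; apply/existsP; exists v.
apply: eq_bigr => S; rewrite enhanced_incidentE => /existsP[v vSU].
rewrite (big_pred1 v) // => w; apply/idP/eqP => [wSU|->//].
by case/and3P: vSU => st _ _; case/and3P: wSU => st' _ _; apply: incident_uniq st' st.
Qed.

(** If [p] is not a set of loops of [s], the default labels all loops [-]; the underlying state is
    [s] in either case. *)
Definition label s p : enhanced D :=
  insubd (Sub (s, set0) (sub0set _)) (s, p).

Lemma label_underlying s p : underlying (label s p) = s.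
Proof. by rewrite /underlying /label val_insubd; case: ifP. Qed.

Lemma label_plus s p : p \subset loops s -> plus_loops (label s p) = p.
Proof. by move=> ps; rewrite /plus_loops /label val_insubd /= ps. Qed.

Lemma labelK S : label (underlying S) (plus_loops S) = S.
Proof.
apply: val_inj; rewrite /label val_insubd -surjective_pairing ifT //.
exact: valP S.
Qed.

Definition flipA t v : state D := [ffun w => (w == v) || t w].

Lemma incident_flipA s t v : ~~ t v -> incident_at s t v = (s == flipA t v).
Proof.
move=> tv; rewrite /incident_at tv; apply/andP/eqP => [[sv /forallP st]|->].
  apply/ffunP=> w; rewrite ffunE; have := st w.
  by case: eqP => [->|_ /eqP].
split; first by rewrite ffunE eqxx.
by apply/forallP=> w; apply/implyP=> /negPf wv; rewrite ffunE wv.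
Qed.

Definition flow_map v (u : {ffun enhanced D -> 'F_2}) : {ffun enhanced D -> 'F_2} :=
  [ffun U => \sum_(S | flow v S U) u S].

(** The part of the chain [u] over the state [s], as an element of the algebra described at
    [marking]. *)
Definition coef (u : {ffun enhanced D -> 'F_2}) s A : 'F_2 :=
  marking (eqv s) (fun p => u (label s p)) A.

(** By [section_ex] each label set is hit by a separated [A], at which [coef] returns the
    coefficient of that enhanced state. *)
Lemma coef_inj u u' : (forall s, coef u s =1 coef u' s) -> u = u'.
Proof.
move=> uu; apply/ffunP=> S; rewrite -(labelK S).
set s := underlying S; set p := plus_loops S.
have [A sepA <-] : exists2 A, separated (eqv s) A & hit_classes (eqv s) A = p.
  by apply: section_ex; [exact: eqv_equiv|rewrite -loopsE; apply: plus_loops_sub].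
by have := uu s A; rewrite /coef /marking sepA.
Qed.

Lemma flow_mapE v u t q : q \subset loops t -> ~~ t v ->
  let s := flipA t v in
  flow_map v u (label t q) =
  \sum_(p : {set {set Defs.arc D}} | [&& p \subset loops s,
      2 * #|p|%:Z - #|loops s|%:Z == 2 * #|q|%:Z - #|loops t|%:Z + 1
      & [forall L in loops s :&: loops t, ~~ Defs.meets L v ==> ((L \in p) == (L \in q))]])
    u (label s p).
Proof.
move=> qt tv s; rewrite ffunE.
rewrite (reindex_onto (label s) (@plus_loops D)) /=; last first.
  move=> S /and3P[+ _ _]; rewrite label_underlying incident_flipA // => /eqP sE.
  rewrite /s -sE; exact: labelK.
apply: eq_bigl => p; rewrite /flow /common_agree !tauE !label_underlying (label_plus qt).
rewrite incident_flipA // eqxx /=.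
case: (boolP (p \subset loops s)) => ps.
  by rewrite (label_plus ps) eqxx andbT.
apply/negP=> /andP[_ /eqP pE]; case/negP: ps.
by have := plus_loops_sub (label s p); rewrite label_underlying pE.
Qed.

Lemma flow_map_A v u s A : s v -> coef (flow_map v u) s A = 0.
Proof.
move=> sv; rewrite /coef /marking; case: ifP => // _; rewrite ffunE big_pred0 // => S.
by apply/negP=> /and3P[/and3P[_ + _] _ _]; rewrite label_underlying sv.
Qed.

Lemma common_eq v s t p q :
  (forall L, L \in loops s :&: loops t -> ~~ Defs.meets L v) ->
  [forall L in loops s :&: loops t,
     ~~ Defs.meets L v ==> ((L \in p) == (L \in q))] = agree (eqv s) (eqv t) p q.
Proof.
move=> nomeet; rewrite /agree -!loopsE; apply: eq_forallb => L.
by case: (boolP (L \in _)) => //= /nomeet ->.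
Qed.

Lemma agreeC (E E' : rel (Defs.arc D)) p q : agree E E' p q = agree E' E p q.
Proof. by apply: eq_forallb => L; rewrite setIC. Qed.

Lemma tau_merge (a b n m : nat) : n = m.+1 ->
  (2 * a%:Z - n%:Z == 2 * b%:Z - m%:Z + 1) = (a == b.+1).
Proof. by move=> ->; apply/eqP/eqP; lia. Qed.

Lemma tau_split (a b n m : nat) : m = n.+1 ->
  (2 * a%:Z - n%:Z == 2 * b%:Z - m%:Z + 1) = (a == b).
Proof. by move=> ->; apply/eqP/eqP; lia. Qed.

(** By parity; this is why a step that keeps the set of loops gives no incidences. *)
Lemma tau_same (a b n : nat) : (2 * a%:Z - n%:Z == 2 * b%:Z - n%:Z + 1) = false.
Proof. by apply/negP=> /eqP; lia. Qed.

Hypothesis evenD : even_diagram D.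

(** The cases of [stepP], with [merge_marking] and [split_marking] for the first two. In these the
    ends at [v] all lie on the loops that merge or split, so no common loop passes through [v]. *)
Lemma coef_flow v u t A (s := flipA t v) : ~~ t v ->
  coef (flow_map v u) t A =
  if ~~ eqv s (nw v) (sw v) then
    add_pt (nw v) (coef u s) A + add_pt (sw v) (coef u s) A
  else if ~~ eqv t (nw v) (ne v) then coef u s A else 0.
Proof.
move=> tv; have st : incident_at s t v by rewrite incident_flipA.
have [sv _ _] := and3P st.
have [sA1 sA2] := eqv_A sv; have [tB1 tB2] := eqv_B tv.
have eqvs := eqv_equiv s; have eqvt := eqv_equiv t.
have [nsw tne tE|nsw tne sE|nsw tne stE] := stepP evenD st; rewrite nsw ?tne /=.
- have ends_out L : L \in loops s :&: loops t -> ~~ Defs.meets L v.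
    rewrite !loopsE => /(common_classP eqvs tE nsw)[a xa ->].
    have out b : eqv t (nw v) b -> b \notin eqv_class (eqv s) a.
      move=> xb; rewrite inE; apply: contra xa => ab; have [_ ts tt] := eqvt.
      by apply: (tt b) => //; rewrite ts tE; apply: sub_merge_rel.
    rewrite /Defs.meets !negb_or !out //; last by case: eqvt.
    case: eqvt => _ _ tt; apply: (tt (Defs.sw v)) => //.
    by rewrite tE; apply: sub_merge_rel.
  rewrite -(merge_marking _ _ eqvs tE nsw); apply: eq_marking => // q.
  rewrite -loopsE => qt; rewrite flow_mapE //; apply: eq_bigl => p.
  rewrite -/s /merge_cond -!loopsE common_eq // tau_merge //.
  by rewrite !loopsE (card_classes_merge eqvs tE nsw).
- have ends_out L : L \in loops s :&: loops t -> ~~ Defs.meets L v.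
    rewrite !loopsE setIC => /(common_classP eqvt sE tne)[a xa ->].
    have out b : eqv s (nw v) b -> b \notin eqv_class (eqv t) a.
      move=> xb; rewrite inE; apply: contra xa => ab; have [_ ss st'] := eqvs.
      by apply: (st' b) => //; rewrite ss sE; apply: sub_merge_rel.
    rewrite /Defs.meets !negb_or !out //; last by case: eqvs.
    case: eqvs => _ _ tt; exact: (tt (Defs.sw v)).
  rewrite /coef -(split_marking eqvt sE tne); apply: eq_marking => // q.
  rewrite -loopsE => qt; rewrite flow_mapE //; apply: eq_bigl => p.
  rewrite -/s /split_cond -!loopsE [agree _ _ _ _]agreeC common_eq; last exact: ends_out.
  by rewrite tau_split // !loopsE (card_classes_merge eqvt sE tne).
- rewrite /coef /marking; case: ifP => // _.
  rewrite flow_mapE // -?loopsE ?hit_sub //; last by rewrite loopsE hit_sub.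
  apply: big_pred0 => p; rewrite -/s !loopsE (eq_classes stE).
  by rewrite tau_same andbF.
Qed.

Lemma add_pt_pair u s a b c d A : eqv s a c -> eqv s b d ->
  add_pt a (coef u s) A + add_pt b (coef u s) A =
  add_pt c (coef u s) A + add_pt d (coef u s) A.
Proof.
move=> ac bd; rewrite (add_pt_marking _ _ (eqv_equiv s) ac).
by rewrite (add_pt_marking _ _ (eqv_equiv s) bd).
Qed.

Lemma F2_addxx (x : 'F_2) : x + x = 0.
Proof. by rewrite -mulr2n -mulr_natr (_ : 2%:R = 0) ?mulr0 //; apply/val_inj. Qed.

Lemma add_pt_loop u s a b A : eqv s a b ->
  add_pt a (coef u s) A + add_pt b (coef u s) A = 0.
Proof.
by move=> ab; rewrite /coef (add_pt_marking _ _ (eqv_equiv s) ab) F2_addxx.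
Qed.

Lemma loops_count s t v : incident_at s t v ->
  (#|loops t| + ~~ eqv s (nw v) (sw v) = #|loops s| + ~~ eqv t (nw v) (ne v))%N.
Proof.
move=> st; have [eqvs eqvt] := (eqv_equiv s, eqv_equiv t).
rewrite !loopsE; have [nsw tne tE|nsw tne sE|nsw tne stE] := stepP evenD st;
  rewrite nsw tne /=.
- by rewrite addn0 addn1 (card_classes_merge eqvs tE nsw).
- by rewrite addn0 addn1 (card_classes_merge eqvt sE tne).
- by rewrite (eq_classes stE).
Qed.

End Enhanced.

(** * The differential squares to zero *)

Section StepOperator.
Variables (T : finType) (V : nmodType).
Implicit Types (f g : {set T} -> V) (A : {set T}).

Definition add_either (a b : T) f A : V := add_pt a f A + add_pt b f A.

(** The right-hand side of [coef_flow], with its two tests as parameters. *)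
Definition step_op (m p : bool) a b f A : V :=
  if ~~ m then add_either a b f A else if ~~ p then f A else 0.

Lemma eq_step_op m p a b f g : f =1 g -> step_op m p a b f =1 step_op m p a b g.
Proof. by move=> fg A; rewrite /step_op /add_either !(eq_add_pt _ _ fg) fg. Qed.

Lemma step_op0 m p a b f A : (forall A, f A = 0) -> step_op m p a b f A = 0.
Proof.
by move=> f0; rewrite /step_op /add_either /add_pt !f0; do !case: ifP => //; rewrite addr0.
Qed.

(** Both sides are products in a commutative algebra. *)
Lemma add_eitherC a b c d f A :
  add_either a b (add_either c d f) A = add_either c d (add_either a b f) A.
Proof.
rewrite /add_either !add_ptD !(add_ptC a) !(add_ptC b).
exact: Monoid.mulmACA.
Qed.

Lemma add_either0 a b A : add_either a b (fun=> 0) A = 0.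
Proof. by rewrite /add_either /add_pt; do 2 case: ifP => _; rewrite addr0. Qed.

(** The two ways around a square of resolutions: [m_i] fails when the [i]-th step
    merges two loops, [p_i] fails when it splits a loop.  The hypothesis on the
    sum says that both ways change the number of loops by the same amount. *)
Lemma step_opC (m1 p1 m2 p2 m3 p3 m4 p4 : bool) a b c d f A :
  m1 || p1 -> m2 || p2 -> m3 || p3 -> m4 || p4 ->
  (~~ m1 + ~~ m2 + ~~ p3 + ~~ p4 = ~~ p1 + ~~ p2 + ~~ m3 + ~~ m4)%N ->
  (m1 -> add_either a b f A = 0) -> (m3 -> add_either c d f A = 0) ->
  (m1 && p1 -> m2 = m3) -> (m3 && p3 -> m4 = m1) ->
  ([&& ~~ m1, ~~ m3 & m2] -> add_either a b f A = add_either c d f A) ->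
  step_op m2 p2 c d (step_op m1 p1 a b f) A =
  step_op m4 p4 a b (step_op m3 p3 c d f) A.
Proof.
case: m1 p1 => -[] //= _; case: m2 p2 => -[] //= _;
case: m3 p3 => -[] //= _; case: m4 p4 => -[] //= _ cnt H1 H3 e1 e3 H13;
(try done); (try by move: cnt); rewrite /step_op /=.
all: try exact: add_eitherC.
all: try by rewrite H1.
all: try by rewrite H3.
all: try by have := e1 isT.
all: try by have := e3 isT.
all: try by rewrite H13.
all: try by rewrite add_either0.
(* Both ways split a loop and merge it back. Each merge adds two variables that act alike on the
   initial state, so both sides vanish. *)
exact: etrans (H3 isT) (esym (H1 isT)).
Qed.

End StepOperator.

(** * Commutation of the components at two crossings *)

Section Square.
Variable D : diagram.
Hypothesis evenD : even_diagram D.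
Implicit Types (s t : state D) (v w : crossing D) (a b : Defs.arc D).

Lemma coef_flow_op v u t : ~~ t v ->
  coef (flow_map v u) t =1
  step_op (eqv (flipA t v) (nw v) (sw v)) (eqv t (nw v) (ne v)) (nw v) (sw v)
    (coef u (flipA t v)).
Proof. by move=> tv A; rewrite coef_flow. Qed.

(** The image of the component at [v] is supported on states with the B-resolution at [v], whereas
    that component reads only states with the A-resolution there. *)
Lemma flow_map_square v u : flow_map v (flow_map v u) = 0.
Proof.
apply: coef_inj => t A; have -> : coef 0 t A = 0.
  by rewrite /coef /marking ffunE; case: ifP.
case: (boolP (t v)) => tv; first exact: flow_map_A.
rewrite coef_flow_op //; apply: step_op0 => B; apply: flow_map_A.
by rewrite ffunE eqxx.
Qed.

Lemma step_weak s t v : incident_at s t v ->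
  eqv s (nw v) (sw v) || eqv t (nw v) (ne v).
Proof. by case/(stepP evenD) => [_ ->|->|->]; rewrite ?orbT. Qed.

Lemma step_same s t v : incident_at s t v ->
  eqv s (nw v) (sw v) && eqv t (nw v) (ne v) -> eqv t =2 eqv s.
Proof. by case/(stepP evenD) => // [/negPf->|_ /negPf->]; rewrite ?andbF. Qed.

Lemma step_merge s t v : incident_at s t v -> ~~ eqv s (nw v) (sw v) ->
  eqv t =2 merge_rel (eqv s) (nw v) (sw v).
Proof. by case/(stepP evenD) => [_ _ //|-> //|-> //]. Qed.

(** Adds up the changes in the number of loops, as given by [loops_count], along the four sides of a
    square of resolutions. *)
Lemma square_count (n1 n2 n3 n4 c1 c2 c3 c4 c5 c6 c7 c8 : nat) :
  (n4 + c8 = n3 + c7 -> n4 + c6 = n2 + c5 -> n3 + c4 = n1 + c3 ->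
   n2 + c2 = n1 + c1 -> c2 + c6 + c3 + c7 = c1 + c5 + c4 + c8)%N.
Proof. by lia. Qed.

Lemma flow_mapC v w u : flow_map w (flow_map v u) = flow_map v (flow_map w u).
Proof.
case: (eqVneq v w) => [->//|vw]; have wv : w != v by rewrite eq_sym.
apply: coef_inj => t A.
(* If [t] has the A-resolution at [v] or at [w], both composites vanish at [t]. *)
have flow0 x y u' : x != y -> t x -> coef (flow_map y (flow_map x u')) t A = 0.
  move=> xy tx; case: (boolP (t y)) => ty; first exact: flow_map_A.
  rewrite coef_flow_op //; apply: step_op0 => B; apply: flow_map_A.
  by rewrite ffunE tx orbT.
case: (boolP (t v)) => tv; first by rewrite flow0 // flow_map_A.
case: (boolP (t w)) => tw; first by rewrite flow_map_A // flow0.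
(* The square from [r], with the A-resolution at both crossings, to [t]; [sv] and [sw'] are its
   intermediate corners. *)
set sv := flipA t v; set sw' := flipA t w; set r := flipA sw' v.
have rE : flipA sv w = r by apply/ffunP=> x; rewrite !ffunE orbCA.
have swv : ~~ sw' v by rewrite ffunE (negPf vw).
have svw : ~~ sv w by rewrite ffunE (negPf wv).
have tv' : incident_at sv t v by rewrite incident_flipA.
have tw' : incident_at sw' t w by rewrite incident_flipA.
have rw' : incident_at r sw' v by rewrite incident_flipA.
have rv' : incident_at r sv w by rewrite incident_flipA // rE.
rewrite (coef_flow_op _ tw) (coef_flow_op _ tv) -/sv -/sw'.
rewrite (eq_step_op _ _ _ _ (coef_flow_op u swv)) (eq_step_op _ _ _ _ (coef_flow_op u svw)).
rewrite rE -/r; apply: step_opC; try exact: step_weak.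
- exact: (square_count (loops_count evenD tv') (loops_count evenD tw')
    (loops_count evenD rv') (loops_count evenD rw')).
- exact: add_pt_loop.
- exact: add_pt_loop.
- by move=> same; rewrite (step_same rw').
- by move=> same; rewrite (step_same rv').
(* At [r] each crossing merges two loops, and after the merge at [v] the ends at [w] lie on one
   loop. So both crossings merge the same two loops of [r], and the sums of variables act alike. *)
case/and3P=> nv nw'; rewrite (step_merge rw' nv) /merge_rel /= (negPf nw') /=.
have [_ rs _] := eqv_equiv r.
case/orP=> /andP[av bw]; last rewrite [RHS]addrC; apply: add_pt_pair => //; by rewrite rs.
Qed.

(** Off the diagonal the terms at [(i, j)] and [(j, i)] cancel in pairs; the enumeration of [I]
    selects one member of each pair. *)
Lemma sum_symmetric (I : finType) (V : zmodType) (f : I -> I -> V) :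
  (forall x : V, x + x = 0) -> (forall i j, f i j = f j i) -> (forall i, f i i = 0) ->
  \sum_i \sum_j f i j = 0.
Proof.
move=> V2 fC f0; pose lt (i j : I) := (enum_rank i < enum_rank j)%N.
have split3 i : \sum_j f i j = \sum_(j | lt i j) f i j + \sum_(j | lt j i) f i j.
  rewrite (bigID (lt i)) /=; congr (_ + _).
  rewrite (bigID (lt^~ i)) /= [X in _ + X]big1 ?addr0 => [|j /andP[ij ji]].
    by apply: eq_bigl => j; rewrite /lt -leqNgt; case: ltngtP.
  suff -> : i = j by [].
  apply: enum_rank_inj; apply/val_inj/eqP; move: ij ji.
  by rewrite /lt -!leqNgt eqn_leq => -> ->.
under eq_bigr do rewrite split3.
rewrite big_split /= (exchange_big_dep xpredT) //=.
by under eq_bigr do under eq_bigr do rewrite fC; apply: V2.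
Qed.

Lemma ffun_F2_addxx (u : {ffun enhanced D -> 'F_2}) : u + u = 0.
Proof. by apply/ffunP=> S; rewrite !ffunE F2_addxx. Qed.

Definition boundary_fun (u : {ffun enhanced D -> 'F_2}) : {ffun enhanced D -> 'F_2} :=
  [ffun U => \sum_(S | enhanced_incident S U) u S].

Lemma boundary_flow u : boundary_fun u = \sum_v flow_map v u.
Proof.
apply/ffunP=> U; rewrite sum_ffunE !ffunE incident_sumE.
by apply: eq_bigr => v _; rewrite ffunE.
Qed.

Lemma flow_map_sum v (I : finType) (f : I -> {ffun enhanced D -> 'F_2}) :
  flow_map v (\sum_i f i) = \sum_i flow_map v (f i).
Proof.
apply/ffunP=> U; rewrite sum_ffunE !ffunE; under eq_bigr do rewrite sum_ffunE.
by rewrite exchange_big; apply: eq_bigr => i _; rewrite ffunE.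
Qed.

Lemma boundary_fun_square u : boundary_fun (boundary_fun u) = 0.
Proof.
rewrite boundary_flow [in LHS]boundary_flow.
under eq_bigr do rewrite flow_map_sum.
apply: sum_symmetric; [exact: ffun_F2_addxx|move=> v w; exact: flow_mapC|move=> v].
exact: flow_map_square.
Qed.

Lemma boundaryE (u : chain D) : boundary D u = boundary_fun u.
Proof.
rewrite /boundary; set f := (f in linfun f).
have fE (x : chain D) : f x = boundary_fun x.
  apply/ffunP=> U; rewrite sum_ffunE ffunE [RHS]big_mkcond.
  apply: eq_bigr => S _; rewrite ffunE sum_ffunE.
  have -> : \sum_(i | enhanced_incident S i) chain_basis i U =
      (enhanced_incident S U)%:R :> 'F_2.
    under eq_bigr do rewrite ffunE eq_sym.
    case: (boolP (enhanced_incident S U)) => SU.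
      by rewrite (bigD1 U) //= eqxx big1 ?addr0 // => T /andP[_ /negPf->].
    by rewrite big1 // => T ST; case: eqP => // TU; rewrite -TU ST in SU.
  by rewrite /GRing.scale /=; case: ifP; rewrite ?mulr1 ?mulr0.
have f_lin : linear f.
  move=> a x y; rewrite !fE; apply/ffunP=> U; rewrite !ffunE scaler_sumr -big_split /=.
  by apply: eq_bigr => S _; rewrite !ffunE.
(* [linfun] is known to agree with its argument only for a function packed as a linear map. *)
pose fL : {linear chain D -> chain D} :=
  HB.pack f (GRing.isLinear.Build _ _ _ _ f f_lin).
by rewrite -fE; apply: (lfunE fL).
Qed.
End Square.

(** * Euler characteristic *)

Section Dimension.
Variable D : diagram.
Implicit Types (S U : enhanced D) (P : {pred enhanced D}) (u : chain D).

Definition supp_space P : {vspace chain D} :=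
  <<[seq chain_basis X | X in P]>>%VS.

Lemma coef_sum_basis (c : enhanced D -> 'F_2) P U :
  (\sum_(X | X \in P) c X *: chain_basis X) U = if U \in P then c U else 0.
Proof.
have cX X : (c X *: chain_basis X) U = c X * (U == X)%:R by rewrite !ffunE.
rewrite sum_ffunE; under eq_bigr do rewrite cX.
case: ifP => UP; last first.
  by rewrite big1 // => X XP; case: eqP => [UX|]; rewrite ?mulr0 // UX XP in UP *.
rewrite (bigD1 U) //= eqxx mulr1 big1 ?addr0 // => X /andP[_ XU].
by rewrite eq_sym (negPf XU) mulr0.
Qed.

Lemma supp_space_mem P u :
  reflect (forall U, U \notin P -> u U = 0) (u \in supp_space P).
Proof.
apply: (iffP idP) => [|u0].
  move=> /(@coord_span _ _ _ (in_tuple _)) -> U UP; rewrite sum_ffunE.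
  apply: big1 => i _; rewrite ffunE [X in _ *: X](_ : _ = 0) ?scaler0 //.
  have : (in_tuple [seq chain_basis X | X in P])`_i \in [seq chain_basis X | X in P].
    by apply: mem_nth.
  by case/imageP=> X XP ->; rewrite ffunE; case: eqP => // UX; rewrite UX XP in UP.
have -> : u = \sum_(X | X \in P) u X *: chain_basis X.
  by apply/ffunP=> U; rewrite coef_sum_basis; case: ifPn => // /u0.
by apply: memv_suml => X XP; apply: memvZ; apply/memv_span/image_f.
Qed.

Lemma dim_supp_space P : \dim (supp_space P) = #|P|.
Proof.
have free_P : free (in_tuple [seq chain_basis X | X in P]).
  have szP : size [seq chain_basis X | X in P] = size (enum P) by rewrite size_map.
  apply/freeP=> k k0 i; have ilt : (i < size (enum P))%N by rewrite -szP.
  (* The index [i] shows that [P] is inhabited, which supplies the default element for [nth]. *)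
  have [X0 _] : exists X, X \in enum P.
    by case: (enum P) ilt => // X s _; exists X; rewrite mem_head.
  have nthE (j : 'I_(size [seq chain_basis X | X in P])) :
      (in_tuple [seq chain_basis X | X in P])`_j = chain_basis (nth X0 (enum P) j).
    by apply: nth_map; rewrite -szP.
  have /ffunP/(_ (nth X0 (enum P) i)) := k0; rewrite sum_ffunE [RHS]ffunE (bigD1 i) //=.
  rewrite big1 ?addr0 => [|j ji]; rewrite nthE !ffunE ?eqxx.
    by move=> <-; rewrite /GRing.scale /= mulr1.
  rewrite nth_uniq ?enum_uniq -?szP // eq_sym; case: eqP => [/val_inj jE|_]; last exact: mulr0.
  by rewrite jE eqxx in ji.
by rewrite cardE -(size_map (@chain_basis D)); apply/eqP.
Qed.

Lemma boundary_square : even_diagram D -> forall u, boundary D (boundary D u) = 0.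
Proof. by move=> evenD u; rewrite !boundaryE boundary_fun_square. Qed.

Definition graded (i k j : int) : pred (enhanced D) :=
  [pred X | [&& igrading X == i%:~R, kgrading X == k%:~R & jgrading X == j%:~R]].

Lemma graded_chainE i k j : graded_chain D i k j = supp_space (graded i k j).
Proof. by []. Qed.

Lemma igrading_incident S U : enhanced_incident S U -> igrading U = igrading S + 1.
Proof.
rewrite enhanced_incidentE => /existsP[v /and3P[st _ _]].
rewrite /igrading (sigma_incident st).
apply: (@mulIf _ (2%:R : rat)) => //; rewrite mulrDl !divfK // mul1r.
rewrite [X in _ = _ + X]pmulrn -intrD; congr _%:~R; ring.
Qed.

Lemma boundary_graded i k j :
  (boundary D @: graded_chain D i k j <= graded_chain D (i + 1) k j)%VS.
Proof.
apply/subvP=> _ /memv_imgP[u uG ->]; rewrite graded_chainE; apply/supp_space_mem => U UG.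
rewrite boundaryE ffunE big1 // => S SU.
move: uG; rewrite graded_chainE => /supp_space_mem; apply.
apply: contra UG; rewrite !inE => /and3P[/eqP iS /eqP kS /eqP jS].
rewrite (igrading_incident SU) iS; case/and3P: SU => /eqP jSU /eqP kSU _.
by rewrite -jSU -kSU kS jS rmorphD !eqxx.
Qed.

Definition rank_boundary i k j := \dim (boundary D @: graded_chain D i k j).

(** Rank and nullity of the differential on the graded piece give the dimension of the cycles. The
    boundaries lie among the cycles, because the differential squares to zero, so the complement has
    the difference as its dimension. *)
Lemma dim_homology i k j : even_diagram D ->
  (\dim (homology D i k j) + rank_boundary i k j + rank_boundary (i - 1) k j
   = #|graded i k j|)%N.
Proof.
move=> evenD; rewrite -dim_supp_space -graded_chainE.
rewrite -(limg_ker_dim (boundary D) (graded_chain D i k j)) addnAC; congr (_ + _)%N.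
rewrite [(graded_chain D i k j :&: _)%VS]capvC.
rewrite -(dimv_cap_compl (lker (boundary D) :&: _)
  (boundary D @: graded_chain D (i - 1) k j)).
rewrite addnC; congr (_ + _)%N; rewrite /rank_boundary; congr (\dim _).
apply/esym/capv_idPr; rewrite subv_cap; apply/andP; split.
  by apply/subvP=> _ /memv_imgP[u uG ->]; rewrite memv_ker boundary_square.
by have := boundary_graded (i - 1) k j; rewrite subrK.
Qed.

End Dimension.

Lemma sum_subset_card (T : finType) (V : nmodType) (B : {set T}) (f : nat -> V) :
  \sum_(p : {set T} | p \subset B) f #|p| = \sum_(m < #|B|.+1) f m *+ 'C(#|B|, m).
Proof.
rewrite (partition_big (fun p : {set T} => inord #|p| : 'I_#|B|.+1) xpredT) //=.
apply: eq_bigr => m _; rewrite -cards_draws -sumr_const.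
apply: eq_big => [p|p /andP[pB /eqP <-]]; rewrite ?inE.
  case: (boolP (p \subset B)) => //= pB.
  by rewrite -val_eqE /= inordK // ltnS subset_leq_card.
by rewrite inordK // ltnS subset_leq_card.
Qed.

Lemma big_uniq_support (I : eqType) (V : nmodType) (r0 r : seq I) (f : I -> V) :
  uniq r0 -> uniq r -> {subset r0 <= r} -> (forall i, i \notin r0 -> f i = 0) ->
  \sum_(i <- r) f i = \sum_(i <- r0) f i.
Proof.
move=> u0 u sub f0; rewrite (bigID (mem r0)) /= [X in _ + X]big1 // addr0 -big_filter.
apply: perm_big; apply: uniq_perm; rewrite ?filter_uniq // => i.
by rewrite mem_filter andb_idr //; apply: sub.
Qed.

(** * The Jones polynomial as a weighted sum over enhanced states *)

Section Euler.
Variable D : diagram.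
Implicit Types (S : enhanced D) (s : state D).

Let N := #|crossing D|.
Let l := left_handed_crossings D.

Lemma writheE : writhe D = N%:Z - 2 * l%:Z.
Proof.
have -> : N = (\sum_(v : crossing D) 1)%N by rewrite sum1_card.
rewrite /l /left_handed_crossings -sum1_card (big_morph Posz PoszD erefl).
rewrite (big_morph Posz PoszD erefl) mulr_sumr [\sum_(v in _) _]big_mkcond -sumrB.
by apply: eq_bigr => v _; rewrite inE; case: right_handed.
Qed.

Lemma sigmaE s : sigma s = N%:Z - 2 * (numB s)%:Z.
Proof.
have NE : (numA s + numB s = N)%N by rewrite /numA /numB (cardC (mem [pred v | s v])).
by rewrite /sigma -NE PoszD; ring.
Qed.

(** The gradings with the halves cleared; [gradedE] identifies them with the rational ones when the
    number of cusps is even. *)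
Definition int_igrading S : int := (numB (underlying S))%:Z - l%:Z.
Definition int_jgrading S : int := writhe D + int_igrading S + tau S.
Definition int_kgrading S : int := (front_cusps D %/ 2)%N%:Z + int_igrading S + tau S.
Definition grading S := (int_igrading S, int_kgrading S, int_jgrading S).

Lemma half_double (x : int) : (2 * x)%:~R / 2 = x%:~R :> rat.
Proof. by rewrite intrM mulrC mulKf. Qed.

Hypothesis even_cusps : ~~ odd (front_cusps D).

Lemma gradedE i k j S : graded i k j S = (grading S == (i, k, j)).
Proof.
rewrite /graded /grading /= !xpair_eqE -andbA.
have -> : igrading S = (int_igrading S)%:~R.
  rewrite -half_double /igrading /int_igrading writheE sigmaE.
  by congr (_%:~R / _); ring.
have -> : jgrading S = (int_jgrading S)%:~R.
  rewrite -half_double /jgrading /int_jgrading /int_igrading writheE sigmaE.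
  by congr (_%:~R / _); ring.
have -> : kgrading S = (int_kgrading S)%:~R.
  rewrite -half_double /kgrading /int_kgrading /int_igrading state_cuspsE.
  have {1}-> : front_cusps D = (2 * (front_cusps D %/ 2))%N.
    by rewrite mulnC divnK // dvdn2.
  by congr (_%:~R / _); rewrite PoszD !PoszM -/l; ring.
by rewrite !eqr_int.
Qed.

Variables (F : comUnitRingType) (A r : F).
Hypotheses (hA : A \is a GRing.unit) (hr : r \is a GRing.unit).
Let q : F := - A ^- 2.

(** A normal form for both sides of the identity, in which the exponent of [-1] matters only modulo
    2. *)
Definition monomial (i a b : int) : F := (-1) ^ i * A ^ a * r ^ b.

Lemma monomialM i a b i' a' b' :
  monomial i a b * monomial i' a' b' = monomial (i + i') (a + a') (b + b').
Proof.
rewrite /monomial !exprzDr // ?unitrN1 //; ring.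
Qed.

Lemma monomial_sign i i' a b d : i = i' + 2 * d -> monomial i a b = monomial i' a b.
Proof.
move=> ->; rewrite /monomial exprzDr ?unitrN1 //.
by rewrite [X in _ * X * _ * _](_ : _ = 1) ?mulr1 // -exprz_exp -exprnP sqrrN expr1n exp1rz.
Qed.

Lemma monomial_ext i a b i' a' b' d :
  a = a' -> b = b' -> i = i' + 2 * d -> monomial i a b = monomial i' a' b'.
Proof. by move=> -> ->; apply: monomial_sign. Qed.

Lemma monomialX i a b n : monomial i a b ^+ n = monomial (i * n%:Z) (a * n%:Z) (b * n%:Z).
Proof. by rewrite /monomial !exprMn -!exprz_exp. Qed.

Definition weight (g : int * int * int) : F :=
  let: (i, k, j) := g in (-1) ^ i * r ^ k * q ^ j.

Lemma weightE i k j : weight (i, k, j) = monomial (i + j) (- (2 * j)) k.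
Proof.
have uA2 : A ^- 2 \is a GRing.unit by rewrite unitrV unitrX.
rewrite /weight /q /monomial -[- A ^- 2]mulN1r exprMz_comm ?unitrN1 //; last exact: mulrC.
rewrite exprnN exprz_exp exprzDr ?unitrN1 // mulNr; ring.
Qed.

Lemma weight_shift i k j : weight (i + 1, k, j) = - weight (i, k, j).
Proof. by rewrite /weight exprzDr ?unitrN1 // expr1z mulrN1 !mulNr. Qed.

(** A loop labelled [+] contributes the factor [q r = - A ^- 2 * r] and a loop labelled [-] its
    inverse. Grouping the labellings by their number [m] of [+] labels gives the binomial expansion
    of the power on the right. *)
Lemma state_sum s :
  \sum_(S | underlying S == s) weight (grading S) =
  (- A) ^ (- (3 * writhe D)) * r ^ ((front_cusps D %/ 2)%N%:Z - l%:Z)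
  * (A ^ sigma s * r ^+ numB s * (- (A ^+ 2) * r^-1 - A ^- 2 * r) ^+ #|loops s|).
Proof.
set n := #|loops s|; set b := numB s; set c := (front_cusps D %/ 2)%N.
have -> : \sum_(S | underlying S == s) weight (grading S) =
    \sum_(p : {set {set Defs.arc D}} | p \subset loops s)
      weight (b%:Z - l%:Z, c%:Z + (b%:Z - l%:Z) + (2 * #|p|%:Z - n%:Z),
              writhe D + (b%:Z - l%:Z) + (2 * #|p|%:Z - n%:Z)).
  rewrite (reindex_onto (label s) (@plus_loops D)) /=; last first.
    by move=> S /eqP <-; apply: labelK.
  apply: eq_big => [p|p /andP[_ /eqP pE]].
    rewrite label_underlying eqxx /=; apply/eqP/idP => [<-|/label_plus //].
    by have := plus_loops_sub (label s p); rewrite label_underlying.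
  rewrite /grading /int_kgrading /int_jgrading /int_igrading.
  by rewrite tauE label_underlying pE.
rewrite (sum_subset_card _ (fun m =>
    weight (b%:Z - l%:Z, c%:Z + (b%:Z - l%:Z) + (2 * m%:Z - n%:Z),
              writhe D + (b%:Z - l%:Z) + (2 * m%:Z - n%:Z)))).
have -> : - (A ^+ 2) * r^-1 - A ^- 2 * r = monomial 1 2 (-1) + monomial 1 (- 2) 1.
  have [A2 A2'] : A ^ 2 = A ^+ 2 /\ A ^ (- 2) = A ^- 2 by [].
  by rewrite /monomial expr1z exprN1 A2 A2' expr1z !mulN1r !mulNr.
have -> : (- A) ^ (- (3 * writhe D)) = monomial (- (3 * writhe D)) (- (3 * writhe D)) 0.
  rewrite /monomial mulr1 -[- A in LHS]mulN1r exprMz_comm ?unitrN1 //; exact: mulrC.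
move: (writhe D) writheE => w wE.
rewrite exprDn !mulr_sumr; apply: eq_bigr => m _; rewrite !mulrnAr -/n; congr (_ *+ _).
have -> : r ^ (c%:Z - l%:Z) = monomial 0 0 (c%:Z - l%:Z) by rewrite /monomial !mul1r.
have -> : A ^ sigma s * r ^+ b = monomial 0 (sigma s) b%:Z.
  by rewrite /monomial mul1r.
rewrite !monomialX !monomialM weightE.
have mn : (m <= n)%N by rewrite -ltnS.
rewrite -subzn // sigmaE wE -/b.
(* The witness is half the difference of the two exponents of [-1]. *)
apply: (@monomial_ext _ _ _ _ _ _ (2 * (N%:Z - 2 * l%:Z) + b%:Z - l%:Z + m%:Z - n%:Z)); ring.
Qed.

Lemma jones_sum : legendrian_jones D A r = \sum_S weight (grading S).
Proof.
rewrite (partition_big (@underlying D) xpredT) //= /legendrian_jones mulr_sumr.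
by apply: eq_bigr => s _; rewrite state_sum.
Qed.

Hypothesis evenD : even_diagram D.

Definition dim_at (g : int * int * int) : nat :=
  let: (i, k, j) := g in \dim (homology D i k j).

Definition rank_at (g : int * int * int) : nat :=
  let: (i, k, j) := g in rank_boundary D i k j.

Definition pred_grade (g : int * int * int) := let: (i, k, j) := g in (i - 1, k, j).
Definition succ_grade (g : int * int * int) := let: (i, k, j) := g in (i + 1, k, j).

Lemma dim_at_rank g :
  (dim_at g + rank_at g + rank_at (pred_grade g) = #|[pred S | grading S == g]|)%N.
Proof.
case: g => [[i k] j]; rewrite /= dim_homology //; apply: eq_card => S.
by rewrite !inE -gradedE.
Qed.

Lemma rank_at_le g : (rank_at g <= #|[pred S | grading S == g]|)%N.
Proof. by rewrite -dim_at_rank -addnA addnCA leq_addr. Qed.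

Lemma euler_characteristic :
  exists rs : seq (int * int * int),
    [/\ uniq rs, forall g, g \notin rs -> dim_at g = 0%N &
     \sum_(g <- rs) weight g * (dim_at g)%:R = legendrian_jones D A r].
Proof.
pose gs := undup [seq grading X | X : enhanced D].
(* The shifted gradings are included because the ranks of incoming differentials,
   [rank_at (pred_grade g)], are supported there. *)
pose rs := undup (gs ++ map succ_grade gs).
have ugs : uniq gs by apply: undup_uniq.
have urs : uniq rs by apply: undup_uniq.
have gs_rs : {subset gs <= rs} by move=> g gg; rewrite mem_undup mem_cat gg.
have card0 g : g \notin gs -> #|[pred S | grading S == g]| = 0%N.
  move=> gg; apply: eq_card0 => S; rewrite !inE; apply/negP=> /eqP Sg.
  by case/negP: gg; rewrite mem_undup -Sg; apply: image_f.
have rank0 g : g \notin gs -> rank_at g = 0%N.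
  by move=> /card0 g0; apply/eqP; rewrite -leqn0 -g0 rank_at_le.
have dim0 g : g \notin gs -> dim_at g = 0%N.
  by move=> /card0 g0; apply/eqP; rewrite -leqn0 -g0 -dim_at_rank -addnA leq_addr.
exists rs; split=> // [g ng|].
  by apply: dim0; apply: contra ng; apply: gs_rs.
have sum_card : \sum_(g <- rs) weight g * #|[pred S | grading S == g]|%:R =
    \sum_S weight (grading S).
  rewrite (big_uniq_support ugs urs gs_rs) => [|g /card0 ->]; last by rewrite mulr0.
  under eq_bigr do rewrite -sum1_card natr_sum mulr_sumr.
  rewrite (exchange_big_dep xpredT) //=; apply: eq_bigr => S _.
  have Sgs : grading S \in gs by rewrite mem_undup image_f.
  rewrite big_mkcond (bigD1_seq _ Sgs ugs) /= !inE eqxx mulr1 big1 ?addr0 //.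
  by move=> g gS; rewrite !inE eq_sym (negPf gS).
rewrite jones_sum -sum_card; symmetry.
under eq_bigr do rewrite -dim_at_rank !natrD !mulrDr.
rewrite !big_split /= -addrA addrC.
suff -> : \sum_(g <- rs) weight g * (rank_at g)%:R +
    \sum_(g <- rs) weight g * (rank_at (pred_grade g))%:R = 0 by rewrite add0r.
have sgK : cancel pred_grade succ_grade by case=> [[i k] j]; rewrite /= subrK.
have psK : cancel succ_grade pred_grade by case=> [[i k] j]; rewrite /= addrK.
rewrite (big_uniq_support ugs urs gs_rs) => [|g /rank0 ->]; last by rewrite mulr0.
rewrite [X in _ + X](@big_uniq_support _ _ (map succ_grade gs)) //; first last.
- move=> g ng; rewrite rank0 ?mulr0 //; apply: contra ng => pg.
  by rewrite -[g]sgK map_f.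
- by move=> g gg; rewrite mem_undup mem_cat gg orbT.
- by rewrite map_inj_uniq //; apply: can_inj psK.
(* Once reindexed by [succ_grade], the second sum cancels the first term by term, as the weight
   changes sign from one degree to the next. *)
rewrite big_map -big_split /= big1 // => -[[i k] j] _.
rewrite psK -mulrDl -[succ_grade _]/(i + 1, k, j) weight_shift.
by rewrite addrN mul0r.
Qed.

End Euler.

From mathcomp Require Import finmap.
From mathcomp Require Import all_classical all_reals all_analysis.

Import numFieldNormedType.Exports.

Local Open Scope classical_set_scope.

(** * Cusps and crossings of a generic front *)

Section SignChanges.
Variables (R : realType) (g : R -> R).
Hypothesis g_cont : continuous g.

Lemma same_sign (a b : R) : a <= b ->
  (forall t, a <= t <= b -> g t != 0) -> (0 < g b) = (0 < g a).
Proof.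
move=> ab g0.
have gab : {within `[a, b], continuous g} by apply: continuous_subspaceT.
have ga : g a != 0 by apply: g0; rewrite lexx.
have gb : g b != 0 by apply: g0; rewrite ab lexx.
have nz : ~ (Num.min (g a) (g b) <= 0 <= Num.max (g a) (g b)).
  move=> /(IVT ab gab)[c]; rewrite in_itv /= => /g0 /eqP; by [].
case: (ltrgtP 0 (g a)) ga => // ga0 _; case: (ltrgtP 0 (g b)) gb => // gb0 _;
  by case: nz; rewrite ge_min le_max ?(ltW ga0) ?(ltW gb0) ?orbT.
Qed.

Definition sign_change (t : R) :=
  ((\forall s \near t^'-, g s < 0) /\ (\forall s \near t^'+, 0 < g s)) \/
  ((\forall s \near t^'-, 0 < g s) /\ (\forall s \near t^'+, g s < 0)).

Hypothesis g_change : forall t, g t = 0 -> sign_change t.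

(** Induction on the zeros: the sign is constant up to the first zero and flips there, and the
    induction hypothesis applies from a point between the first zero and the next. *)
Lemma sign_parity (zs : seq R) (a b : R) :
  a < b -> g a != 0 -> g b != 0 -> sorted <%R zs ->
  (forall z, (z \in zs) = (a < z < b) && (g z == 0)) ->
  (0 < g b) = (0 < g a) (+) odd (size zs).
Proof.
elim: zs a => [|z zs IH] a ab ga gb /=.
  move=> _ zsE; rewrite addbF; apply: same_sign => [|t /andP[ta tb]]; first exact: ltW.
  apply/negP=> gt; have := zsE t; rewrite in_nil gt andbT !lt_neqAle ta tb !andbT.
  have -> : a != t by apply: contraNneq ga => ->.
  by have -> : t != b by apply: contraNneq gb => <-.
move=> zs_sort zsE.
have := zsE z; rewrite mem_head => /esym/andP[/andP[az zb] /eqP gz].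
have z_min y : y \in zs -> z < y by move=> yz; apply: (allP (order_path_min lt_trans zs_sort)).
have zh : z < head b zs.
  by case: (zs) z_min => // y ys; apply; rewrite mem_head.
have hb y : y \in zs -> head b zs <= y.
  case: (zs) zs_sort => //= h ys /andP[_ hs]; rewrite inE => /predU1P[->//|yy].
  by apply/ltW/(allP (order_path_min lt_trans hs)).
(* The points [z1] and [z2] sample the sign on either side of [z]; [head b zs] is the next zero, or
   [b] if there is none. *)
have finish (z1 z2 : R) : a < z1 < z -> z < z2 < head b zs ->
    g z1 != 0 -> g z2 != 0 -> (0 < g z2) = ~~ (0 < g z1) ->
    (0 < g b) = (0 < g a) (+) ~~ odd (size zs).
  move=> /andP[az1 z1z] /andP[zz2 z2h] g1 g2 g12.
  have hb' : head b zs <= b.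
    case: (zs) zsE => //= h ys zsE; have := zsE h; rewrite !inE eqxx orbT.
    by case/esym/andP=> /andP[_ /ltW].
  have zE y : (y \in zs) = (z2 < y < b) && (g y == 0).
    apply/idP/andP => [yzs|[/andP[z2y yb] gy]].
      have := zsE y; rewrite inE yzs orbT => /esym/andP[/andP[_ ->] ->].
      by rewrite (lt_le_trans z2h) ?hb.
    have := zsE y; rewrite inE yb gy !andbT (lt_trans az (lt_trans zz2 z2y)).
    by case: eqP => // yz _; move: (lt_trans zz2 z2y); rewrite yz ltxx.
  rewrite (IH z2) ?(lt_le_trans z2h) ?(path_sorted zs_sort) // g12.
  rewrite (@same_sign a z1); first by rewrite addNb addbN.
    exact: ltW.
  move=> t /andP[ta tz1]; apply/negP=> gt.
  have at' : a < t by rewrite lt_neqAle ta andbT; apply: contraNneq ga => ->.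
  have tz : t < z := le_lt_trans tz1 z1z.
  have := zsE t; rewrite at' (lt_trans tz zb) gt inE => /orP[/eqP tz'|/z_min zt].
    by rewrite tz' ltxx in tz.
  by have := lt_trans tz zt; rewrite ltxx.
case: (g_change gz) => -[gl gr].
  have [z1 [[z1a z1z] g1]] : exists z1, (a < z1 /\ z1 < z) /\ g z1 < 0.
    apply: (@filter_ex _ z^'-); apply: filterI => //; apply: filterI;
      first exact: nbhs_left_gt.
    exact: nbhs_left_lt.
  have [z2 [[zz2 z2h] g2]] : exists z2, (z < z2 /\ z2 < head b zs) /\ 0 < g z2.
    apply: (@filter_ex _ z^'+); apply: filterI => //; apply: filterI;
      first exact: nbhs_right_gt.
    exact: nbhs_right_lt.
  apply: (finish z1 z2); rewrite ?z1a ?z1z ?zz2 ?z2h ?(lt_eqF g1) ?(gt_eqF g2) //.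
  by rewrite g2 ltNge (ltW g1).
have [z1 [[z1a z1z] g1]] : exists z1, (a < z1 /\ z1 < z) /\ 0 < g z1.
  apply: (@filter_ex _ z^'-); apply: filterI => //; apply: filterI;
      first exact: nbhs_left_gt.
  exact: nbhs_left_lt.
have [z2 [[zz2 z2h] g2]] : exists z2, (z < z2 /\ z2 < head b zs) /\ g z2 < 0.
  apply: (@filter_ex _ z^'+); apply: filterI => //; apply: filterI;
      first exact: nbhs_right_gt.
  exact: nbhs_right_lt.
apply: (finish z1 z2); rewrite ?z1a ?z1z ?zz2 ?z2h ?(gt_eqF g1) ?(lt_eqF g2) //.
by rewrite g1 ltNge (ltW g2).
Qed.

Lemma left_nonzero (t : R) : g t = 0 ->
  exists2 e : R, 0 < e & forall s, t - e < s < t -> g s != 0.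
Proof.
move=> gt; have : \forall s \near t^'-, g s != 0.
  case: (g_change gt) => -[gl _]; apply: filterS gl => s.
    by move/lt_eqF->.
  by move/gt_eqF->.
case/nbhs_ballP=> e /= e0 H; exists e => // s /andP[ts st].
apply: H => //; rewrite /ball /= ltr_norml; apply/andP; split.
  by rewrite (lt_trans (_ : - e < 0)) ?oppr_lt0 // subr_gt0.
by rewrite ltrBlDr addrC -ltrBlDr.
Qed.

(** Over a full period [g] returns to its initial sign, so [sign_parity] forces an even number of
    zeros. *)
Lemma even_sign_changes (zs : seq R) : (forall t, g (t + 1) = g t) ->
  sorted <%R zs -> (forall z, (z \in zs) = (0 <= z < 1) && (g z == 0)) ->
  ~~ odd (size zs).
Proof.
move=> g_per zs_sort zsE.
suff [t0 [t01 gt0 t0E]] : exists t0, [/\ -1 < t0 <= 0, g t0 != 0 & forall z,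
    (z \in zs) = (t0 < z < t0 + 1) && (g z == 0)].
  have := @sign_parity zs t0 (t0 + 1); rewrite g_per ltrDl ltr01.
  by move=> /(_ isT gt0 gt0 zs_sort t0E); case: (0 < g t0); case: odd.
case: (eqVneq (g 0) 0) => g0; last first.
  exists 0; split; rewrite ?lexx ?ltrN10 // => z; rewrite zsE add0r le_eqVlt.
  by case: eqP => //= <-; rewrite ltxx ltr01 (negPf g0).
have [e e0 ge] := left_nonzero g0.
(* Starting the period just before [0] keeps its endpoints off the zeros. *)
pose t0 := - (Num.min e 1 / 2).
have [t0e t0N1 t0_lt0] : [/\ - e < t0, -1 < t0 & t0 < 0].
  have m0 : 0 < Num.min e 1 by rewrite lt_min e0 ltr01.
  have m2 : Num.min e 1 / 2 < Num.min e 1 by rewrite ltr_pdivrMr // ltr_pMr // ltrDl.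
  rewrite /t0 oppr_lt0 !ltrN2 divr_gt0 //; split=> //.
    by rewrite (lt_le_trans m2) // ge_min lexx.
  by rewrite (lt_le_trans m2) // ge_min lexx orbT.
have nz s : t0 <= s < 0 -> g s != 0.
  by case/andP=> ts s0; apply: ge; rewrite sub0r s0 (lt_le_trans t0e).
exists t0; split=> [||z]; first by rewrite t0N1 ltW.
  by apply: nz; rewrite lexx.
(* There is no zero from [t0] up to [0], hence by periodicity none from [t0 + 1] up to [1]; so both
   windows contain the same zeros. *)
rewrite zsE; case: (boolP (g z == 0)) => gz; rewrite ?andbF // !andbT.
apply/andP/andP => [[z0 z1]|[tz zt]].
  rewrite (lt_le_trans t0_lt0) //; split=> //; rewrite ltNge; apply/negP=> tz.
  have := nz (z - 1); rewrite -g_per subrK gz lerBrDr tz subr_lt0 z1.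
  by move=> /(_ isT).
split; last by rewrite (lt_trans zt) // gtrDr.
by rewrite leNgt; apply/negP=> z0; have := nz z; rewrite (ltW tz) z0 gz => /(_ isT).
Qed.

End SignChanges.

(** * Parity of the cusps and of the arc ends of a knot front *)

Section KnotFront.
Variables (R : realType) (K : legendrian_knot R).
Hypothesis hK : generic_front K.

Lemma kx'_periodic t : derive1 (kx K) (t + 1) = derive1 (kx K) t.
Proof.
rewrite /derive1; congr (lim _).
have -> : (fun h => h^-1 *: (kx K (h + (t + 1)) - kx K (t + 1))) =
          (fun h => h^-1 *: (kx K (h + t) - kx K t)).
  apply/funext => h; rewrite addrA.
  by have [-> _ _] := knot_periodic K (h + t); have [-> _ _] := knot_periodic K t.
by [].
Qed.

Lemma kx'_continuous : continuous (derive1 (kx K)).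
Proof.
move=> t; have [sx _ _] := knot_smooth K.
by apply/differentiable_continuous/derivable1_diffP; apply: (sx 1%N t).
Qed.

Lemma front_cusps_even : ~~ odd (front_cusps (front_diagram K)).
Proof.
have fin := generic_finite_cusps hK.
set zs := sort <=%R (fset_set (cusp_times K)).
have -> : front_cusps (front_diagram K) = size zs by rewrite size_sort.
apply: (even_sign_changes kx'_continuous) => [t gt|||z].
- by case: (generic_cusps hK gt) => -[_ gl gr]; [left|right].
- exact: kx'_periodic.
- by rewrite sort_lt_sorted fset_uniq.
rewrite mem_sort in_fset_set //; apply/idP/andP => [|[z01 /eqP z0]]; rewrite !inE //.
by case=> z01 /eqP.
Qed.

Notation ts := (crossing_time_seq K).

Lemma mem_ts t : t \in ts -> crossing_times K t.
Proof. by rewrite mem_sort in_fset_set ?inE //; apply: generic_finite_crossings. Qed.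

Lemma ts_mem t : crossing_times K t -> t \in ts.
Proof.
by move=> ct; rewrite mem_sort in_fset_set ?inE //; apply: generic_finite_crossings.
Qed.

(** By the Legendrian condition the determinant is the product of both derivatives of [x] with the
    difference of the [y]-coordinates. Its being nonzero rules out cusps at crossings, so slopes are
    these coordinates, and makes them differ. *)
Lemma crossing_slope s t : 0 <= s < 1 -> 0 <= t < 1 -> s != t ->
  front K s = front K t -> slope K s != slope K t.
Proof.
move=> s01 t01 st fst; have := generic_transverse hK s01 t01 st fst.
rewrite /front_det /slope !knot_legendrian => det0.
have [s0 t0] : derive1 (kx K) s != 0 /\ derive1 (kx K) t != 0.
  by split; apply: contraNneq det0 => ->; rewrite ?(mulr0, mul0r) subrr.
rewrite !mulfK //; apply: contraNneq det0 => ->.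
by rewrite mulrCA mulrA subrr.
Qed.

Lemma arc_start_mem (i : knot_arc K) : (0 < size ts)%N -> arc_start i \in ts.
Proof. by move=> n0; rewrite mem_nth // -[X in (_ < X)%N]prednK. Qed.

Lemma arc_start_inj : (0 < size ts)%N -> injective (@arc_start R K).
Proof.
move=> n0 i j /eqP; rewrite nth_uniq ?sort_uniq ?fset_uniq //.
- by move/eqP/val_inj.
- by rewrite -[X in (_ < X)%N]prednK.
- by rewrite -[X in (_ < X)%N]prednK.
Qed.

Lemma arc_start_surj t : t \in ts -> exists i : knot_arc K, arc_start i = t.
Proof.
move=> tt; have n0 : (0 < size ts)%N by case: (ts) tt.
have lt : (index t ts < (size ts).-1.+1)%N by rewrite prednK // index_mem.
by exists (Ordinal lt); rewrite /arc_start nth_index.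
Qed.

(** Genericity gives each crossing time exactly one partner, and the slopes decide which of the two
    is the over-strand. Hence [i] names one strand of one crossing. *)
Lemma strand_count (i : knot_arc K) : (0 < size ts)%N ->
  (\sum_(v : knot_crossing K) ((over v == i) + (under v == i)) = 1)%N.
Proof.
move=> n0; have inj := arc_start_inj n0.
have mem01 (j : knot_arc K) : 0 <= arc_start j < 1.
  by have [] := mem_ts (arc_start_mem j n0).
have [_ [s [s01 sti fs]]] := mem_ts (arc_start_mem i n0).
have [j jE] : exists j : knot_arc K, arc_start j = s.
  apply: arc_start_surj; apply: ts_mem; split=> //.
  by exists (arc_start i); split; rewrite // 1?eq_sym.
have ij : i != j by apply: contraNneq sti => ->; rewrite jE.
have fij : front K (arc_start i) = front K (arc_start j) by rewrite jE.
have partner k : k != i -> front K (arc_start k) = front K (arc_start i) -> k = j.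
  move=> ki fki; have := generic_double hK (mem01 k) (mem01 i) (mem01 j) fki fij.
  rewrite !(inj_eq inj) (negPf ki) (negPf ij) /= => /eqP //.
have slij : slope K (arc_start i) != slope K (arc_start j).
  by apply: crossing_slope; rewrite ?(inj_eq inj).
have vP (v : knot_crossing K) : front K (arc_start (over v)) = front K (arc_start (under v)) /\
    slope K (arc_start (over v)) < slope K (arc_start (under v)).
  by have /andP[/eqP] := valP v.
have over_under (v : knot_crossing K) : over v != under v.
  by apply/eqP=> vv; have [_] := vP v; rewrite vv ltxx.
have only (v : knot_crossing K) : (over v == i) || (under v == i) ->
    (over v, under v) =
      if slope K (arc_start i) < slope K (arc_start j) then (i, j) else (j, i).
  have [fv sv] := vP v; have ov := over_under v; case/orP=> /eqP vi.
    have uj : under v = j by apply: partner; rewrite -vi 1?eq_sym.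
    by move: sv; rewrite vi uj => ->.
  have uj : over v = j by apply: partner; rewrite -vi.
  by move: sv; rewrite vi uj => /lt_gtF ->.
have [v0 v0E] : exists v : knot_crossing K,
    (over v, under v) =
      if slope K (arc_start i) < slope K (arc_start j) then (i, j) else (j, i).
  case: ifPn => sl.
    have H : (front K (arc_start (i, j).1) == front K (arc_start (i, j).2))
      && (slope K (arc_start (i, j).1) < slope K (arc_start (i, j).2)) by rewrite fij eqxx.
    by exists (Sub (i, j) H); rewrite /over /under SubK.
  have H : (front K (arc_start (j, i).1) == front K (arc_start (j, i).2))
      && (slope K (arc_start (j, i).1) < slope K (arc_start (j, i).2)).
    by rewrite fij eqxx /= lt_neqAle eq_sym slij leNgt.
  by exists (Sub (j, i) H); rewrite /over /under SubK.
rewrite (bigD1 v0) //= big1 ?addn0 => [|v vv0].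
  by move: v0E; case: ifP => _ [-> ->]; rewrite eqxx eq_sym (negPf ij).
apply/eqP; rewrite addn_eq0 !eqb0 -negb_or; apply: contra vv0 => /only vE.
apply/eqP/val_inj; move: vE; rewrite -v0E /over /under.
by case: (val v) => ? ?; case: (val v0) => ? ? /= [-> ->].
Qed.

Lemma west_east (i a : knot_arc K) :
  ((west i == a) + (east i == a) = (i == a) + (ord_pred i == a))%N.
Proof. by rewrite /west /east; case: ifP => // _; rewrite addnC. Qed.

(** Exchanging west and east does not affect the count, so each crossing time contributes one end to
    the arriving arc and one to the leaving arc. Summed cyclically, every arc has two ends. *)
Lemma front_diagram_even : even_diagram (front_diagram K).
Proof.
move=> a; have [n0|n0] := posnP (size ts).
  (* Without crossing times [arc_start] is the default [0] of [nth], so the strict inequality of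
     slopes fails and there are no crossings. *)
  have a0 (i : knot_arc K) : arc_start i = 0
    by apply: nth_default; apply: leq_trans (leq0n _); rewrite n0.
  by rewrite big1 // => v; have /andP[_] := valP v; rewrite !a0 ltxx.
pose f (i : knot_arc K) := ((i == a) + (ord_pred i == a))%N.
have -> : (\sum_(v : crossing (front_diagram K)) ends_in (pred1 a) v =
   \sum_(v : knot_crossing K) (f (over v) + f (under v)))%N.
  apply: eq_bigr => v _; rewrite /ends_in /f -!west_east !inE /=.
  by rewrite addnAC [X in (X + _)%N]addnAC -addnA [X in (_ + X)%N]addnC.
have delta (i : knot_arc K) : (\sum_j (i == j) * f j = f i)%N.
  by rewrite (bigD1 i) //= eqxx mul1n big1 ?addn0 // => j; rewrite eq_sym => /negPf->.
have -> : (\sum_(v : knot_crossing K) (f (over v) + f (under v)) = \sum_i f i)%N.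
  have -> : (\sum_i f i = \sum_(i : knot_arc K) \sum_(v : knot_crossing K)
      ((over v == i) * f i + (under v == i) * f i))%N.
    apply: eq_bigr => i _; under eq_bigr do rewrite -mulnDl.
    by rewrite -big_distrl /= strand_count // mul1n.
  by rewrite exchange_big /=; apply: eq_bigr => v _; rewrite big_split /= !delta.
have sum1 : (\sum_(i : knot_arc K) (i == a) = 1)%N.
  by rewrite (bigD1 a) //= eqxx big1 // => i /negPf->.
have sum2 : (\sum_(i : knot_arc K) (ord_pred i == a) = 1)%N.
  by rewrite -[RHS]sum1 [RHS](reindex_inj (@ord_pred_inj _)).
by rewrite /f big_split /= sum1 sum2.
Qed.

End KnotFront.

Theorem theorem1p3 (R : realType) (K : legendrian_knot R)
    (hK : generic_front K) (F : comUnitRingType) (A r : F)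
    (hA : A \is a GRing.unit) (hr : r \is a GRing.unit) :
  let q := - A ^- 2 in
  \sum_(g \in [set: int * int * int])
    (let: (i, k, j) := g in
     (-1) ^ i * r ^ k * q ^ j * (\dim (homology (front_diagram K) i k j))%:R)
  = legendrian_jones (front_diagram K) A r.
Proof.
move=> q; have [rs [urs rs0 <-]] :=
  euler_characteristic (front_cusps_even hK) hA hr (front_diagram_even hK).
(* Homology vanishes outside the gradings in [rs], so the sum over all triples has finite
   support. *)
rewrite (fsbigE rs) //=; last first.
  by move=> [[i k] j] _ /rs0 /= ->; rewrite mulr0.
apply: eq_big => [g|[[i k] j] _ //]; exact: mem_set.
Qed.
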